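(* For every integer $d\geqslant 6$, there are exactly $290$ admissible monomials of weight vector $(4)|(2)|^{d-2}$ in $P_5$ all of whose exponents are positive. Consequently $\dim QP_5^+((4)|(2)|^{d-2})=290$ and $\dim QP_5((4)|(2)|^{d-2})=465$.
   Context: $P_k=\mathbb F_2[x_1,\dots,x_k]$, $\deg x_i=1$, with the standard action of the mod-2 Steenrod algebra $\mathcal A$; $\mathcal A^+$ is the augmentation ideal. For a monomial $x$, $\nu_j(x)$ is the exponent of $x_j$, $\alpha_i(a)$ the $i$-th binary digit of $a$, the weight vector is $\omega(x)=(\omega_i(x))_{i\ge1}$ with $\omega_i(x)=\sum_j\alpha_{i-1}(\nu_j(x))$, the exponent vector is $\sigma(x)=(\nu_1(x),\dots,\nu_k(x))$; both ordered left-lexicographically, and for monomials of equal degree $u<v$ iff $\omega(u)<\omega(v)$, or $\omega(u)=\omega(v)$ and $\sigma(u)<\sigma(v)$. A monomial $u$ is admissible unless there are monomials $v_1,\dots,v_r<u$ with $u+\sum v_j\in\mathcal A^+P_k$. For a weight vector $\omega$ with $\deg\omega=\sum_i2^{i-1}\omega_i$: $P_k(\omega)$ (resp. $P_k^-(\omega)$) is spanned by monomials $y$ of degree $\deg\omega$ with $\omega(y)\le\omega$ (resp. $<\omega$); $QP_k(\omega)=P_k(\omega)/((\mathcal A^+P_k\cap P_k(\omega))+P_k^-(\omega))$; $P_k^+$ is spanned by monomials with all exponents positive and $QP_k^+(\omega)$ is the image of $P_k^+\cap P_k(\omega)$ in $QP_k(\omega)$. Notation: $(4)|(2)|^{d-2}=(4,2,\dots,2,0,\dots)$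 with $d-2$ twos. *)

(* Defs.v *)
(* Mod-2 Steenrod algebra action on P_k = F_2[x_1..x_k],
   homogeneous component of degree n realised as the F_2-vector space
   'rV['F_2]_#|mon k n| with basis the monomials of degree n. *)
From HB Require Import structures.
From mathcomp Require Import all_boot all_order all_algebra.
Set Implicit Arguments. Unset Strict Implicit. Unset Printing Implicit Defensive.
Import GRing.Theory.
Local Open Scope ring_scope.

(* Monomials of degree n in k variables: exponent vectors (nu_1..nu_k)
   (indices 0..k-1) with sum n.  Each exponent is <= n. *)
Definition mon (k n : nat) : predArgType :=
  {a : {ffun 'I_k -> 'I_n.+1} | (\sum_(j < k) (a j : nat) == n)%N}.

Definition expo k n (u : mon k n) (j : 'I_k) : nat := val u j.

Definition Pdeg (k n : nat) := 'rV['F_2]_#|mon k n|.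

Definition emon k n (u : mon k n) : Pdeg k n := delta_mx 0 (enum_rank u).

(* Sq^i (x^a) = sum_{|b| = |a| + i} prod_j C(a_j, b_j - a_j) x^b  (total
   square Sq(x) = x + x^2 and the Cartan formula).  Given an exponent
   vector a of degree n - i, this is the element Sq^i(x^a) of degree n. *)
Definition sq_mon k n (a : 'I_k -> nat) : Pdeg k n :=
  \row_(c < #|mon k n|)
     ((\prod_(j < k) ('C(a j, expo (enum_val c) j - a j)
                       * (a j <= expo (enum_val c) j)))%N)%:R.

(* (A^+ P_k) in degree n: A^+ P_k = sum_{i>0} Im Sq^i (every element of
   A^+ is a sum of products Sq^{i_1}...Sq^{i_r}, r>=1, i_t > 0), and Im Sq^i
   in degree n is spanned by the Sq^i of monomials of degree n - i. *)
Definition hit (k n : nat) : {vspace Pdeg k n} :=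
  <<[seq sq_mon n (expo a) | i <- iota 1 n, a <- enum (mon k (n - i))]>>%VS.

Definition alpha (i a : nat) : bool := odd (a %/ 2 ^ i).

(* weight vector, 0-indexed: weight u i = omega_{i+1}(u) = sum_j alpha_i(nu_j(u)) *)
Definition weight k n (u : mon k n) (i : nat) : nat :=
  (\sum_(j < k) alpha i (expo u j))%N.

(* left-lexicographic comparison of sequences nat -> nat, looking at the
   indices < L.  For monomials of degree n and weight vectors of degree n,
   all entries with index >= n vanish, so L = n.+1 gives the exact order. *)
Definition lex_eq (L : nat) (f g : nat -> nat) : bool :=
  [forall i : 'I_L, f i == g i].
Definition lex_lt (L : nat) (f g : nat -> nat) : bool :=
  [exists i : 'I_L, [forall j : 'I_L, (j < i)%N ==> (f j == g j)] && (f i < g i)%N].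

Definition sigma_lt k n (u v : mon k n) : bool :=
  [exists j : 'I_k, [forall l : 'I_k, (l < j)%N ==> (expo u l == expo v l)]
                    && (expo u j < expo v j)%N].

Definition mon_lt k n (u v : mon k n) : bool :=
  lex_lt n.+1 (weight u) (weight v)
  || (lex_eq n.+1 (weight u) (weight v) && sigma_lt u v).

Definition admissible k n (u : mon k n) : bool :=
  emon u \notin
    (hit k n + <<[seq emon v | v <- enum (mon k n) & mon_lt v u]>>)%VS.

Definition posmon k n (u : mon k n) : bool := [forall j, (0 < expo u j)%N].

Definition wdeg (L : nat) (w : nat -> nat) : nat := (\sum_(i < L) 2 ^ i * w i)%N.

Definition Pw k n (w : nat -> nat) : {vspace Pdeg k n} :=
  <<[seq emon u | u <- enum (mon k n)
       & lex_lt n.+1 (weight u) w || lex_eq n.+1 (weight u) w]>>%VS.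
Definition Pw_minus k n (w : nat -> nat) : {vspace Pdeg k n} :=
  <<[seq emon u | u <- enum (mon k n) & lex_lt n.+1 (weight u) w]>>%VS.
Definition Pw_plus k n (w : nat -> nat) : {vspace Pdeg k n} :=
  <<[seq emon u | u <- enum (mon k n)
       & posmon u && (lex_lt n.+1 (weight u) w || lex_eq n.+1 (weight u) w)]>>%VS.

Definition QPrel k n (w : nat -> nat) : {vspace Pdeg k n} :=
  ((hit k n :&: Pw k n w) + Pw_minus k n w)%VS.

(* dim QP_k(omega) = dim P_k(omega) - dim(relations)  (relations <= P_k(omega)) *)
Definition dimQP k n (w : nat -> nat) : nat :=
  (\dim (Pw k n w) - \dim (QPrel k n w))%N.

(* dim QP_k^+(omega) = dim of the image of P_k^+ cap P_k(omega) in QP_k(omega) *)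
Definition dimQPplus k n (w : nat -> nat) : nat :=
  (\dim (Pw_plus k n w + QPrel k n w) - \dim (QPrel k n w))%N.

(* the weight vector (4)|(2)|^{d-2}, 0-indexed: omega_1 = 4,
   omega_2 = ... = omega_{d-1} = 2, the rest 0 *)
Definition omega_d (d : nat) (i : nat) : nat :=
  if i == 0%N then 4%N else if (i < d.-1)%N then 2%N else 0%N.

(* Main.v *)
From Stdlib Require Import PArith FMapPositive.
Require Import Defs.
From HB Require Import structures.
From mathcomp Require Import all_boot all_order all_algebra.
From mathcomp Require Import zify mpoly.
Set Implicit Arguments. Unset Strict Implicit. Unset Printing Implicit Defensive.
Import GRing.Theory.
Local Open Scope nat_scope.

(** Monomials of weight [(4)|(2)|^s], [s = d - 2], are the words
    [(i; S_1 ... S_s)], standing for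
    [(\prod_(j != i) x_j) * \prod_l (x_a x_b) ^ 2 ^ l] with [S_l = {a, b}].

    Upper bound.  Modulo hits and lower weights, the words satisfy relations
    that involve only a few consecutive letters: letters commute,
    [SST = STT] when [S] and [T] meet, the Pluecker relation
    [bc.ad + ac.bd + ab.cd] and its version with the first letter of each
    term doubled, and [\sum_(i != j) (i; ij ...)].  For [s >= 5] they make the
    class of a word depend only on [i] and on the set of its letters; linear
    algebra on sets of at most five letters, then induction on the number of
    letters, leaves [465] words.  For [s = 4] they leave a space of dimension
    [500], and [35] further hit elements of degree [64] bring it down to [465].

    Lower bound.  Substituting linear forms in [t_1, ..., t_4] for the
    variables commutes with the Steenrod squares, and the coefficient of the
    spike [t_1 ^ (2 ^ s.+1 - 1) t_2 ^ (2 ^ s.+1 - 1) t_3 t_4] kills hit elements.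
    On a word such a functional is a 4 x 4 minor times a product of 2 x 2
    minors, and [465] of these functionals are independent on the [465] words.

    Positivity.  The squares preserve the set of variables of a monomial, so
    the projection onto the positive monomials preserves hit elements.  The
    admissible positive monomials of the given weight are those at which the
    span of the positive monomials, added in increasing order modulo hits and
    lower weights, grows. *)

(** * Steenrod squares on exponent vectors *)

(* The [t] with ['C(a, t)] odd are those whose binary digits are among those of
   [a] (Lucas). *)
Fixpoint subm_rec (f a : nat) : seq nat :=
  if f is f'.+1 then
    if a == 0 then [:: 0] else
    let s := subm_rec f' a./2 in
    [seq t.*2 | t <- s] ++ (if odd a then [seq t.*2.+1 | t <- s] else [::])
  else [:: 0].
Definition subm a := subm_rec a a.

Lemma subm_rec_fuel f g a : a <= f -> a <= g -> subm_rec f a = subm_rec g a.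
Proof.
elim: f g a => [|f IH] [|g] a //=; rewrite ?leqn0.
- by move=> /eqP-> _.
- by move=> _ /eqP->.
move=> lef leg; case: eqP => // a0; rewrite (IH g) //; lia.
Qed.

Lemma subm_double (b : bool) a :
  subm (b + a.*2) =
  [seq t.*2 | t <- subm a] ++ (if b then [seq t.*2.+1 | t <- subm a] else [::]).
Proof.
case: (posnP (b + a.*2)) => [|pos].
  by case: b a => [] [|a].
rewrite {1}/subm; case def: (b + a.*2) pos => [//|m] _ /=.
have -> : uphalf m = a by rewrite -[uphalf m]/(m.+1./2) -def half_bit_double.
have -> : ~~ odd m = b by rewrite -[~~ odd m]/(odd m.+1) -def oddD odd_double addbF oddb.
by rewrite (@subm_rec_fuel m a) //; lia.
Qed.

(** The terms of [Sq^B(x^a)], by the Cartan formula and [Sq^t(x^m) = C(m, t) x^(m + t)]; only the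
    odd binomial coefficients contribute. *)
Fixpoint sqt (a : seq nat) (B : nat) : seq (seq nat) :=
  if a is x :: a' then
    flatten [seq [seq (x + t) :: c | c <- sqt a' (B - t)] | t <- subm x & t <= B]
  else if B == 0 then [:: [::]] else [::].

(** The terms of the total square of [x^a], in all degrees at once; [big_sqall] recovers [Sq^B] as
    its part of degree [sumn a + B]. *)
Fixpoint sqall (a : seq nat) : seq (seq nat) :=
  if a is x :: a' then
    flatten [seq [seq (x + t) :: c | c <- sqall a'] | t <- subm x]
  else [:: [::]].

Lemma sqt_spec a B c : c \in sqt a B -> size c = size a /\ sumn c = sumn a + B.
Proof.
elim: a B c => [|x a IH] B c /=.
  by case: B => // ; rewrite inE => /eqP->.
case/flatten_mapP=> t; rewrite mem_filter => /andP[tB _] /mapP[c' /IH[sz sm] ->] /=.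
by rewrite sz sm; split=> //; lia.
Qed.

Section Sums.
Variable V : nmodType.
Implicit Types g : seq nat -> V.
Local Open Scope ring_scope.

Lemma big_sqt_cons g x a B :
  \sum_(c <- sqt (x :: a) B) g c =
  \sum_(t <- subm x | (t <= B)%N) \sum_(c <- sqt a (B - t)) g ((x + t)%N :: c).
Proof.
rewrite /= big_flatten big_map big_filter; apply: eq_bigr => t _.
by rewrite big_map.
Qed.

Lemma big_sqall_cons g x a :
  \sum_(c <- sqall (x :: a)) g c =
  \sum_(t <- subm x) \sum_(c <- sqall a) g ((x + t)%N :: c).
Proof. by rewrite /= big_flatten big_map; apply: eq_bigr => t _; rewrite big_map. Qed.

Lemma big_sqall g a B :
  \sum_(c <- sqt a B) g c = \sum_(c <- sqall a | sumn c == (sumn a + B)%N) g c.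
Proof.
elim: a B g => [|x a IH] B g.
  rewrite /= big_cons big_nil /= add0n eq_sym; case: eqP => _.
    by rewrite big_cons big_nil.
  by rewrite big_nil.
rewrite big_sqt_cons big_mkcond [RHS]big_mkcond big_sqall_cons.
apply: eq_bigr => t _; case: leqP => tB.
  rewrite IH big_mkcond; apply: eq_bigr => c _ /=.
  by congr (if _ then _ else _); apply/eqP/eqP; lia.
rewrite big1_seq // => c /andP[_ cin] /=.
case: eqP => // E; exfalso.
suff: (sumn a <= sumn c)%N by lia.
elim: a c cin {IH E} => [|y a IHa] c /=; first by rewrite inE => /eqP->.
by case/flatten_mapP=> u _ /mapP[c' /IHa le ->] /=; lia.
Qed.

Lemma big_subm_double (g : nat -> V) (b : bool) a :
  \sum_(t <- subm (b + a.*2)) g t =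
  \sum_(t <- subm a) g t.*2 + (if b then \sum_(t <- subm a) g t.*2.+1 else 0).
Proof.
rewrite subm_double big_cat big_map /=; congr (_ + _).
by case: b; rewrite ?big_map ?big_nil.
Qed.
End Sums.

(** The exponents of the squarefree monomial given by [X] times the square of [x^e]: [X] becomes the
    lowest layer of binary digits. The weight vector is read off by undoing [push] repeatedly. *)
Definition push (X : seq bool) (e : seq nat) : seq nat :=
  [seq nat_of_bool p.1 + p.2.*2 | p <- zip X e].

Lemma size_push X e : size X = size e -> size (push X e) = size e.
Proof. by move=> h; rewrite size_map size_zip h minnn. Qed.

Lemma sumn_push X e : size X = size e -> sumn (push X e) = count id X + (sumn e).*2.
Proof.
elim: X e => [|b X IH] [|x e] //= [] /IH; rewrite /push /= => ->; lia.
Qed.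

Lemma odd_push X e : size X = size e -> map odd (push X e) = X.
Proof.
elim: X e => [|b X IH] [|x e] //= [] /IH; rewrite /push /= => ->.
by rewrite oddD odd_double addbF oddb.
Qed.

Lemma half_push X e : size X = size e -> map half (push X e) = e.
Proof.
elim: X e => [|b X IH] [|x e] //= [] /IH; rewrite /push /= => ->.
by rewrite half_bit_double.
Qed.

Definition bits_sub (c X : seq bool) := all2 implb c X.

Lemma bits_sub_count (c X : seq bool) :
  bits_sub c X -> c <> X -> count id c < count id X.
Proof.
rewrite /bits_sub.
have le : forall c X : seq bool, all2 implb c X -> count id c <= count id X.
  by elim=> [|x s IH] [|y t] //= /andP[xy /IH]; case: x y xy => [] [] //=; lia.
elim: c X => [|x c IH] [|y X] //= /andP[xy sub] ne.
have [E|/eqP cX] := eqVneq c X.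
  by rewrite E in ne *; case: x y xy ne => [] [] //= _ ne; (try by case: ne); lia.
have := IH _ sub cX; by case: x y xy {ne} => [] [] //=; lia.
Qed.

(** Squares contribute only even exponents, and a positive square on [x_j] gives [x_j^2]. So a
    Steenrod square can delete digits of the lowest layer but never create one. *)
Lemma sqt_push_bits X a B c : size X = size a ->
  c \in sqt (push X a) B -> bits_sub (map odd c) X.
Proof.
elim: X a B c => [|b X IH] [|x a] B c //=.
  by case: B => //; rewrite inE => _ /eqP->.
case=> sz /flatten_mapP[t]; rewrite mem_filter => /andP[_].
rewrite subm_double mem_cat => tin /mapP[c' /(IH _ _ _ sz) sub ->] /=.
apply/andP; split=> //; apply/implyP.
rewrite !oddD odd_double addbF oddb.
case/orP: tin => [/mapP[u _ ->]|]; first by rewrite odd_double addbF.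
by case: b.
Qed.

(** By the Cartan formula, the terms of [Sq^(2B)(x^X (x^a)^2)] that leave [x^X] alone form
    [x^X (Sq^B x^a)^2]. Every other term loses a digit of the lowest layer and is killed by the
    hypothesis on [g]. *)
Lemma big_sqt_push (V : nmodType) (g : seq nat -> V) X a B : size X = size a ->
  (forall c, size c = size a -> sumn c = sumn (push X a) + B.*2 ->
     bits_sub (map odd c) X -> map odd c <> X -> g c = 0%R) ->
  (\sum_(c <- sqt (push X a) B.*2) g c = \sum_(c <- sqt a B) g (push X c))%R.
Proof.
elim: X a B g => [|b X IH] [|x a] B g //=.
  by case: B => [|B] //= _ _; rewrite ?big_cons ?big_nil.
case=> sz vanish.
rewrite -/(push X a) -/(sqt (_ :: push X a) B.*2) -/(sqt (x :: a) B) !big_sqt_cons.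
rewrite big_mkcond big_subm_double -[RHS]GRing.addr0; congr (_ + _)%R.
  rewrite [RHS]big_mkcond; apply: eq_bigr => t _; rewrite leq_double.
  case: ifP => // tB; rewrite -doubleB IH //.
    rewrite !big_seq; apply: eq_bigr => c /sqt_spec[sc _].
    by congr g; rewrite /push /=; congr (_ :: _); lia.
  move=> c sc sm sub ne; apply: vanish; rewrite /= ?sc //.
  - by rewrite sm /push /=; lia.
  - by rewrite !oddD !odd_double !addbF oddb sub andbT implybb.
  by case.
(* An odd increment turns the odd first exponent into an even one, so these terms vanish. *)
case: ifP => // bT; rewrite big1 // => t _; case: ifP => // tB.
rewrite big1_seq // => c /andP[_ cin].
have sub := sqt_push_bits sz cin.
have [sc sm] := sqt_spec cin; apply: vanish.
- by rewrite /= sc size_push.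
- by rewrite /= sm /push /=; lia.
- rewrite /= sub andbT bT; by case: odd.
- by move=> /= [] E _; move: E; rewrite bT /= !oddD /= !odd_double.
Qed.

Lemma count_odd e : count odd e = count id (map odd e).
Proof. by rewrite count_map. Qed.

(* Only the first [size w] entries of the weight vector of [e] are compared. *)
Fixpoint lexlow (w e : seq nat) : bool :=
  if w is w0 :: w' then
    let c := count odd e in (c < w0) || (c == w0) && lexlow w' (map half e)
  else false.

(* [F] kills the monomials whose weight is below [w] and the images of all
   Sq^B, B > 0, in degree [n]. *)
Definition good (V : nmodType) k w n (F : seq nat -> V) :=
  (forall e, size e = k -> sumn e = n -> lexlow w e -> F e = 0%R) /\
  (forall a B, size a = k -> 0 < B -> sumn a + B = n ->
     (\sum_(c <- sqt a B) F c = 0)%R).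

(* For [B < 2 ^ r] and [a < 2 ^ r], [Sq^B] leaves a factor [x ^ (2 ^ r * y)]
   untouched: this restriction of [good] is inherited by [F] with a tail fixed. *)
Definition goodb (V : nmodType) r k w n (F : seq nat -> V) :=
  (forall e, size e = k -> sumn e = n -> lexlow w e -> F e = 0%R) /\
  (forall a B, size a = k -> all (ltn^~ (2 ^ r)) a -> 0 < B < 2 ^ r -> sumn a + B = n ->
     (\sum_(c <- sqt a B) F c = 0)%R).

Lemma good_goodb (V : nmodType) r k w n (F : seq nat -> V) :
  good k w n F -> goodb r k w n F.
Proof. by case=> K H; split=> // a B sa _ /andP[B0 _]; apply: H. Qed.

(** Terms that lose a digit of [X] have fewer than [w0] odd exponents, hence lower weight, so
    [big_sqt_push] applies. This strips the lowest level of a monomial. *)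
Lemma good_push (V : nmodType) k w0 w n (F : seq nat -> V) X :
  good k (w0 :: w) (w0 + n.*2) F -> size X = k -> count id X = w0 ->
  good k w n (F \o push X).
Proof.
move=> [K H] sX cX; split=> [e se sm low|a B sa B0 sm] /=.
  apply: K; rewrite ?size_push ?sumn_push ?sX ?se ?cX ?sm //=.
  by rewrite count_odd odd_push ?half_push ?cX ?eqxx ?low ?orbT ?sX.
rewrite -big_sqt_push; last first.
- move=> c sc sm' sub ne; have lt := bits_sub_count sub ne.
  apply: K; rewrite ?sc ?sm' ?sumn_push ?cX ?sX ?sa //; first by lia.
  by rewrite /= count_odd -cX lt.
- by rewrite sX sa.
apply: H; rewrite ?size_push ?sumn_push ?sX ?sa ?cX //; lia.
Qed.

(** The exponents of [x^e] times the [2 ^ r]-th power of [x^y]. *)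
Definition tailadd r (e y : seq nat) : seq nat := [seq p.1 + 2 ^ r * p.2 | p <- zip e y].

Lemma size_tailadd r e y : size e = size y -> size (tailadd r e y) = size e.
Proof. by move=> h; rewrite size_map size_zip h minnn. Qed.

Lemma sumn_tailadd r e y : size e = size y ->
  sumn (tailadd r e y) = sumn e + 2 ^ r * sumn y.
Proof.
elim: e y => [|x e IH] [|z y] //=; first by rewrite muln0.
by case=> /IH; rewrite /tailadd /= => ->; lia.
Qed.

Lemma lexlow_tailadd w e y : size e = size y ->
  lexlow w (tailadd (size w) e y) = lexlow w e.
Proof.
elim: w e => [//|w0 w IH] e sz /=.
have oddE : map odd (tailadd (size w).+1 e y) = map odd e.
  elim: e y sz {IH} => [|x e IHe] [|z y] //= [] /IHe; rewrite /tailadd /= => ->.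
  by congr (_ :: _); rewrite oddD expnS -mulnA mul2n odd_double addbF.
have halfE : map half (tailadd (size w).+1 e y) = tailadd (size w) (map half e) y.
  elim: e y sz {IH oddE} => [|x e IHe] [|z y] //= [] /IHe; rewrite /tailadd /= => ->.
  congr (_ :: _); rewrite expnS -mulnA mul2n; lia.
by rewrite !count_odd oddE halfE IH // size_map.
Qed.

(** A [t] below [2 ^ r] involves only the last [r] binary digits, and those of [a + 2 ^ r * z] are
    the digits of [a]. *)
Lemma big_subm_high (V : nmodType) (g : nat -> V) r a z B : a < 2 ^ r -> B < 2 ^ r ->
  (\sum_(t <- subm (a + 2 ^ r * z)%N | (t <= B)%N) g t = \sum_(t <- subm a | (t <= B)%N) g t)%R.
Proof.
elim: r a z B g => [|r IH] a z B g aR bR.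
  have -> : a = 0 by lia.
  have -> : B = 0 by lia.
  rewrite expn0 mul1n add0n big_mkcond [RHS]big_mkcond /subm /= big_cons big_nil.
  rewrite GRing.addr0 -/(subm z).
  elim/ltn_ind: z g {aR bR} => z IHz g.
  rewrite -{1}[z]odd_double_half big_subm_double.
  case: (posnP z) => [->|z0]; first by rewrite /= big_cons big_nil /= !GRing.addr0.
  have D t : (t.*2 <= 0) = (t <= 0) by lia.
  rewrite (eq_bigr (fun t => if t <= 0 then g t.*2 else 0%R)); last by move=> t _; rewrite D.
  rewrite (IHz z./2 _ (fun t => g t.*2)); last by lia.
  by case: ifP => _; rewrite ?big1_eq GRing.addr0.
have E : a + 2 ^ r.+1 * z = odd a + (a./2 + 2 ^ r * z).*2.
  by rewrite -{1}[a]odd_double_half expnS; lia.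
rewrite E -{3}[a]odd_double_half big_mkcond [RHS]big_mkcond !big_subm_double.
have aux c (h : nat -> V) : c < 2 ->
   (\sum_(t <- subm (a./2 + 2 ^ r * z)%N) (if (t.*2 + c <= B)%N then h t else 0) =
   \sum_(t <- subm a./2) (if (t.*2 + c <= B)%N then h t else 0))%R.
  move=> c2; have [cB|Bc] := leqP c B; last first.
    by rewrite !big1 // => t _; case: leqP => //; lia.
  have P t : (t.*2 + c <= B) = (t <= (B - c)./2) by lia.
  under eq_bigr do rewrite P; under [RHS]eq_bigr do rewrite P.
  rewrite -!big_mkcond IH //; rewrite expnS in aR bR; lia.
congr (_ + _)%R.
  have := aux 0 (fun t => g t.*2) isT.
  by under eq_bigr do rewrite addn0; under [RHS]eq_bigr do rewrite addn0.
case: odd => //; have := aux 1 (fun t => g t.*2.+1) isT.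
by under eq_bigr do rewrite addn1; under [RHS]eq_bigr do rewrite addn1.
Qed.

(** For [B < 2 ^ r], the operation [Sq^B] is linear over [2 ^ r]-th powers. *)
Lemma big_sqt_tail (V : nmodType) (g : seq nat -> V) r a y B : size a = size y ->
  all (ltn^~ (2 ^ r)) a -> B < 2 ^ r ->
  (\sum_(c <- sqt (tailadd r a y) B) g c = \sum_(c <- sqt a B) g (tailadd r c y))%R.
Proof.
elim: a y B g => [|x a IH] [|z y] B g //=.
  by case: B => [|B] _ _ _; rewrite ?big_cons ?big_nil.
case=> sz /andP[xR aR] BR.
rewrite -/(sqt (_ :: tailadd r a y) B) -/(sqt (x :: a) B) !big_sqt_cons big_subm_high //.
apply: eq_bigr => t tB; rewrite IH //; last by lia.
by apply: eq_bigr => c _; congr g; rewrite /tailadd /= addnAC.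
Qed.

(** Strips the highest levels of a monomial, as [good_push] strips the lowest one. Together they
    reduce a relation at any position of a word to a finite check on a few levels. *)
Lemma good_tail (V : nmodType) k w1 w2 n (F : seq nat -> V) y :
  good k (w1 ++ w2) (n + 2 ^ size w1 * sumn y) F -> size y = k ->
  goodb (size w1) k w1 n (fun e => F (tailadd (size w1) e y)).
Proof.
move=> [K H] sy; split=> [e se sm low|a B sa aR /andP[B0 BR] sm] /=.
  apply: K; rewrite ?size_tailadd ?sumn_tailadd ?se ?sm //.
  have : lexlow w1 (tailadd (size w1) e y) by rewrite lexlow_tailadd ?se.
  move: (tailadd _ _ _) => e'; clear; elim: w1 e' => //= w0 w1 IH e' /orP[->//|].
  by case/andP=> -> /IH ->; rewrite orbT.
rewrite -big_sqt_tail ?sa //; apply: H; rewrite ?size_tailadd ?sumn_tailadd ?sa //; lia.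
Qed.

(** * Certificates: explicit sums of Steenrod squares *)

Section Certificates.
Variable V : zmodType.
Hypothesis char2 : forall x : V, (x + x = 0)%R.

Definition cancel_pairs (T : eqType) (s : seq T) :=
  foldr (fun x acc => if x \in acc then rem x acc else x :: acc) [::] s.

Lemma big_cancel_pairs (T : eqType) (g : T -> V) s :
  (\sum_(c <- cancel_pairs s) g c = \sum_(c <- s) g c)%R.
Proof.
elim: s => //= x s IH; rewrite big_cons -IH; case: ifP => xin; last by rewrite big_cons.
by rewrite [in RHS](big_rem x xin) /= GRing.addrA char2 GRing.add0r.
Qed.

(** A certificate lists pairs [(B, a)] and stands for the sum of the [Sq^B(x^a)]. This is its
    expansion modulo 2 and modulo weights below [w]. *)
Definition certeval w (cert : seq (nat * seq nat)) :=
  cancel_pairs (flatten [seq [seq c <- sqt x.2 x.1 | ~~ lexlow w c] | x <- cert]).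

Definition certwf r k n (cert : seq (nat * seq nat)) :=
  all (fun x => [&& size x.2 == k, all (ltn^~ (2 ^ r)) x.2, 0 < x.1 < 2 ^ r
                  & sumn x.2 + x.1 == n]) cert.

Lemma cert_sum r k w n (F : seq nat -> V) cert : goodb r k w n F ->
  certwf r k n cert -> (\sum_(e <- certeval w cert) F e = 0)%R.
Proof.
move=> [K H] /allP wf; rewrite big_cancel_pairs big_flatten big_map big1_seq //.
case=> B a /andP[_ /wf /=] /and4P[/eqP sa aR B0 /eqP sm].
rewrite big_filter; have := H a B sa aR B0 sm; rewrite (bigID (lexlow w)) /=.
rewrite [X in (X + _)%R = _]big1_seq ?GRing.add0r // => c /andP[low /sqt_spec[sc smc]].
by apply: K; rewrite ?sc // smc.
Qed.
End Certificates.

(** * Gaussian elimination over the field with two elements *)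

Lemma positive_eqP : Equality.axiom Pos.eqb.
Proof. by move=> a b; apply: (iffP idP) => /Pos.eqb_eq. Qed.
HB.instance Definition _ := hasDecEq.Build positive positive_eqP.

(** Addition of vectors over the field with two elements, each stored as the decreasing list of the
    positions of its nonzero entries; the head of the list is the pivot. *)
Fixpoint symdiff (u v : seq positive) : seq positive :=
  match u with
  | [::] => v
  | a :: u' =>
    (fix aux v := match v with
     | [::] => u
     | b :: v' => match Pos.compare a b with
                  | Eq => symdiff u' v'
                  | Gt => a :: symdiff u' v
                  | Lt => b :: aux v'
                  end
     end) v
  end.

Definition vec_of (s : seq positive) : seq positive :=
  foldr (fun x => symdiff [:: x]) [::] s.

(* Only a termination bound: too little fuel makes [spanned] return [false]. *)
Definition fuel : nat := Nat.pow 2 12.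

(** The map [m] sends a pivot to the row with that pivot. Only the leading entry is cleared at each
    round. *)
Fixpoint reduce (f : nat) (m : PositiveMap.t (seq positive)) (v : seq positive) :=
  match f, v with
  | f'.+1, h :: _ =>
    match PositiveMap.find h m with
    | Some u => reduce f' m (symdiff v u)
    | None => v
    end
  | _, _ => v
  end.

Definition insert_row m (r : seq positive) :=
  match reduce fuel m (vec_of r) with
  | [::] => m
  | h :: t => PositiveMap.add h (h :: t) m
  end.

Definition eliminate (rows : seq (seq positive)) :=
  foldl insert_row (PositiveMap.empty (seq positive)) rows.

Definition spanned (rows targets : seq (seq positive)) : bool :=
  let m := eliminate rows in
  all (fun v => if reduce fuel m (vec_of v) is [::] then true else false) targets.

Section Solve.
Variable V : zmodType.
Hypothesis char2 : forall x : V, (x + x = 0)%R.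
Variable f : positive -> V.
Let ev (v : seq positive) := (\sum_(c <- v) f c)%R.

Lemma ev_symdiff u v : ev (symdiff u v) = (ev u + ev v)%R.
Proof.
rewrite /ev; elim: u v => [|a u IHu] v; first by rewrite big_nil GRing.add0r.
elim: v => [|b v IHv] /=; first by rewrite big_nil GRing.addr0.
case: Pos.compare_spec => [->|_|_].
- rewrite IHu !big_cons GRing.addrACA char2 GRing.add0r //.
- by rewrite big_cons [X in (_ + X)%R]IHv !big_cons GRing.addrCA.
- by rewrite big_cons IHu !big_cons GRing.addrA.
Qed.

Arguments symdiff : simpl never.

Lemma ev_vec_of s : ev (vec_of s) = ev s.
Proof.
elim: s => //= x s IH; rewrite ev_symdiff IH.
by rewrite /ev big_cons big_nil GRing.addr0 big_cons.
Qed.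

Let sound m := forall h u, PositiveMap.find h m = Some u -> ev u = 0%R.

Lemma ev_reduce g m v : sound m -> ev (reduce g m v) = ev v.
Proof.
move=> snd; elim: g v => [|g IH] [|h v] //=.
case E: PositiveMap.find => [u|//].
by rewrite IH ev_symdiff (snd _ _ E) GRing.addr0.
Qed.

Lemma sound_insert_row m r : sound m -> ev r = 0%R -> sound (insert_row m r).
Proof.
move=> snd r0; rewrite /insert_row; have := ev_reduce fuel (vec_of r) snd.
rewrite ev_vec_of r0; case: reduce => // h t ht h' u.
rewrite PositiveMapAdditionalFacts.gsspec; case: PositiveMap.E.eq_dec => [_ [<-]//|_].
exact: snd.
Qed.

(** The invariant [sound] says that the functional kills every stored row. Reduction then preserves
    its value, so a vector that reduces to the empty list has value zero. *)
Lemma spannedP rows targets v : spanned rows targets ->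
  (forall r, r \in rows -> (\sum_(c <- r) f c = 0)%R) ->
  v \in targets -> (\sum_(c <- v) f c = 0)%R.
Proof.
move=> /allP chk rows0 /chk.
have : sound (eliminate rows).
  rewrite /eliminate.
  have : sound (PositiveMap.empty (seq positive)) by move=> h u; rewrite PositiveMap.gempty.
  elim: rows (PositiveMap.empty _) rows0 {chk} => [//|r rows IH] m rows0 snd /=.
  apply: IH => [r' r'in|]; first by apply: rows0; rewrite inE r'in orbT.
  by apply: sound_insert_row => //; apply: rows0; rewrite mem_head.
move=> /(ev_reduce fuel (vec_of v)); rewrite ev_vec_of.
by case: reduce => // + _; rewrite /ev big_nil.
Qed.
End Solve.

(** * Words, relations and the basis *)

Definition pairs : seq (nat * nat) :=
  [:: (0, 1); (0, 2); (0, 3); (0, 4); (1, 2); (1, 3); (1, 4); (2, 3); (2, 4); (3, 4)].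
Definition in_letter (S j : nat) : bool :=
  let p := nth (0, 0) pairs S in (j == p.1) || (j == p.2).
Definition letter (a b : nat) : nat := index (minn a b, maxn a b) pairs.
Definition bits (S : nat) : seq bool := map (in_letter S) (iota 0 5).
Definition cobits (i : nat) : seq bool := [seq j != i | j <- iota 0 5].

Fixpoint pexp (u : seq nat) : seq nat :=
  if u is x :: u' then push (bits x) (pexp u') else nseq 5 0.
Definition wexp (i : nat) (u : seq nat) : seq nat := push (cobits i) (pexp u).

Fixpoint pdeg s := if s is s'.+1 then 2 + (pdeg s').*2 else 0.
Definition wdegree s := 4 + (pdeg s).*2.
Definition wvec s := 4 :: nseq s 2.

Definition lincomb (f : nat -> nat) : seq nat := map f (iota 0 5).

Definition adjacent (S T : nat) : bool :=
  (S != T) && has (fun j => in_letter S j && in_letter T j) (iota 0 5).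

(* For [S = ab] and [T = ac]: [Sq^1(a^3 b c)].  For disjoint [S = ab], [T = cd]:
   [Sq^2(abcd) + Sq^1(abc^2d) + Sq^1(abcd^2)]. *)
Definition comm_cert (S T : nat) : seq (nat * seq nat) :=
  let s j := (in_letter S j : nat) in let t j := (in_letter T j : nat) in
  if adjacent S T then [:: (1, lincomb (fun j => s j + t j + s j * t j))]
  else let p := nth (0, 0) pairs T in
    [:: (2, lincomb (fun j => s j + t j));
        (1, lincomb (fun j => s j + t j + (j == p.1)));
        (1, lincomb (fun j => s j + t j + (j == p.2)))].

Definition comm_check : bool :=
  all (fun S => all (fun T => (S == T) ||
    (certwf 2 5 6 (comm_cert S T) &&
     perm_eq (certeval [:: 2; 2] (comm_cert S T)) [:: pexp [:: S; T]; pexp [:: T; S]]))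
    (iota 0 10)) (iota 0 10).

(* [x_0 ... x_4 / x_i] times the square of the monomial with exponents [e]; its
   image under [Sq^2B] is, modulo lower weights, that of [e] under [Sq^B]. *)
Definition over_x i (e : nat -> nat) : seq nat := push (cobits i) (lincomb e).

Definition quads : seq (nat * nat * nat * nat) :=
  [seq (abc, d) | abc <- [seq (ab, c) | ab <- [seq (a, b) | a <- iota 0 5, b <- iota 0 5],
     c <- iota 0 5], d <- iota 0 5].

Definition rel : Type := (seq (nat * seq nat))%type.

(* An element [((l, r), c)] of the lists below says that the sum [r] of words with
   [l] letters is certified by the sum [c] of Steenrod squares.  Here [c] comes
   from [Sq^1(a^7 b^3 c^3)]. *)
Definition adj_rels i : seq ((nat * rel) * seq (nat * seq nat)) :=
  [seq ((3, [:: (i, [:: p.1; p.1; p.2]); (i, [:: p.2; p.2; p.1])]),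
        [:: (2, over_x i (fun j => 3 * in_letter p.1 j + 3 * in_letter p.2 j
                                   + in_letter p.1 j * in_letter p.2 j))])
  | p <- [seq (x, y) | x <- iota 0 10, y <- iota 0 10] & (p.1 < p.2) && adjacent p.1 p.2].

Definition letter_pairs : seq (nat * nat) :=
  [seq p <- [seq (x, y) | x <- iota 0 10, y <- iota 0 10] | p.1 < p.2].

Definition tri4 : seq (nat * nat * nat * nat) :=
  [seq q <- quads | let: (a, b, c, d) := q in [&& a < b, b < c, d != a, d != b & d != c]].

(* From [Sq^1(abcd^2)]. *)
Definition pl_rels i : seq ((nat * rel) * seq (nat * seq nat)) :=
  [seq let: (a, b, c, d) := q in
       ((2, [:: (i, [:: letter b c; letter a d]); (i, [:: letter a c; letter b d]);
             (i, [:: letter a b; letter c d])]),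
        [:: (2, over_x i (fun j => (j == a) + (j == b) + (j == c) + 2 * (j == d)))])
  | q <- tri4 & let: (a, b, c, d) := q in c < d].

(* From [Sq^1(a^3 b^3 c^3 d^4)]. *)
Definition dpl_rels i : seq ((nat * rel) * seq (nat * seq nat)) :=
  [seq let: (a, b, c, d) := q in
       ((3, [:: (i, [:: letter b c; letter b c; letter a d]);
                (i, [:: letter a c; letter a c; letter b d]);
                (i, [:: letter a b; letter a b; letter c d])]),
        [:: (2, over_x i (fun j => 3 * (j == a) + 3 * (j == b) + 3 * (j == c) + 4 * (j == d)))])
  | q <- tri4].

(** From [Sq^1] of [x_j^3] times the other four variables; the term with [x_j^4] has lower
    weight. *)
Definition q_rels : seq ((nat * rel) * seq (nat * seq nat)) :=
  [seq ((1, [seq (i, [:: letter i j]) | i <- iota 0 5 & i != j]),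
        [:: (1, lincomb (fun l => 1 + 2 * (l == j)))])
  | j <- iota 0 5].

Definition certified_rels :=
  flatten [seq pl_rels i ++ adj_rels i ++ dpl_rels i | i <- iota 0 5] ++ q_rels.

Definition rels_check : bool :=
  all (fun x => let l := x.1.1 in
    [&& certwf l.+1 5 (wdegree l) x.2,
        all (fun y => [&& y.1 < 5, size y.2 == l & all (ltn^~ 10) y.2]) x.1.2
      & perm_eq (certeval (wvec l) x.2) [seq wexp y.1 y.2 | y <- x.1.2]])
  certified_rels.

Definition rels : seq (nat * rel) := unzip1 certified_rels.

(* Found by linear algebra.  [pad] below turns these words into words of any
   length [s >= 4]; one list serves all [s] because repeated letters do not change
   the values of the functionals used for the lower bound. *)
Definition basis : seq (nat * seq nat) :=
  [:: (0, [:: 0]); (0, [:: 1]); (0, [:: 2]); (0, [:: 3]); (0, [:: 4]); (0, [:: 5]);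
   (0, [:: 6]); (0, [:: 7]); (0, [:: 8]); (0, [:: 9]); (1, [:: 0]); (1, [:: 1]);
   (1, [:: 2]); (1, [:: 3]); (1, [:: 4]); (1, [:: 5]); (1, [:: 6]); (1, [:: 7]);
   (1, [:: 8]); (1, [:: 9]); (2, [:: 0]); (2, [:: 1]); (2, [:: 2]); (2, [:: 3]);
   (2, [:: 4]); (2, [:: 5]); (2, [:: 6]); (2, [:: 7]); (2, [:: 8]); (2, [:: 9]);
   (3, [:: 0]); (3, [:: 1]); (3, [:: 2]); (3, [:: 3]); (3, [:: 4]); (3, [:: 5]);
   (3, [:: 6]); (3, [:: 7]); (3, [:: 8]); (4, [:: 0]); (4, [:: 1]); (4, [:: 2]);
   (4, [:: 4]); (4, [:: 5]); (4, [:: 7]); (0, [:: 0; 1]); (0, [:: 0; 2]);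
   (0, [:: 0; 3]); (0, [:: 0; 4]); (0, [:: 0; 5]); (0, [:: 0; 6]); (0, [:: 0; 7]);
   (0, [:: 0; 8]); (0, [:: 0; 9]); (0, [:: 1; 2]); (0, [:: 1; 3]); (0, [:: 1; 4]);
   (0, [:: 1; 5]); (0, [:: 1; 6]); (0, [:: 1; 7]); (0, [:: 1; 8]); (0, [:: 1; 9]);
   (0, [:: 2; 3]); (0, [:: 2; 5]); (0, [:: 2; 6]); (0, [:: 2; 7]); (0, [:: 2; 8]);
   (0, [:: 2; 9]); (0, [:: 3; 6]); (0, [:: 3; 8]); (0, [:: 3; 9]); (0, [:: 4; 5]);
   (0, [:: 4; 6]); (0, [:: 4; 7]); (0, [:: 4; 8]); (0, [:: 4; 9]); (0, [:: 5; 6]);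
   (0, [:: 5; 7]); (0, [:: 5; 8]); (0, [:: 5; 9]); (0, [:: 6; 8]); (0, [:: 6; 9]);
   (0, [:: 7; 8]); (0, [:: 7; 9]); (0, [:: 8; 9]); (1, [:: 0; 1]); (1, [:: 0; 2]);
   (1, [:: 0; 3]); (1, [:: 0; 4]); (1, [:: 0; 5]); (1, [:: 0; 6]); (1, [:: 0; 7]);
   (1, [:: 0; 8]); (1, [:: 0; 9]); (1, [:: 1; 2]); (1, [:: 1; 3]); (1, [:: 1; 4]);
   (1, [:: 1; 5]); (1, [:: 1; 6]); (1, [:: 1; 7]); (1, [:: 1; 8]); (1, [:: 1; 9]);
   (1, [:: 2; 3]); (1, [:: 2; 5]); (1, [:: 2; 6]); (1, [:: 2; 7]); (1, [:: 2; 8]);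
   (1, [:: 2; 9]); (1, [:: 3; 6]); (1, [:: 3; 8]); (1, [:: 3; 9]); (1, [:: 4; 5]);
   (1, [:: 4; 6]); (1, [:: 4; 7]); (1, [:: 4; 8]); (1, [:: 4; 9]); (1, [:: 5; 6]);
   (1, [:: 5; 7]); (1, [:: 5; 8]); (1, [:: 5; 9]); (1, [:: 6; 8]); (1, [:: 6; 9]);
   (1, [:: 7; 8]); (1, [:: 7; 9]); (1, [:: 8; 9]); (2, [:: 0; 1]); (2, [:: 0; 2]);
   (2, [:: 0; 3]); (2, [:: 0; 4]); (2, [:: 0; 5]); (2, [:: 0; 6]); (2, [:: 0; 7]);
   (2, [:: 0; 8]); (2, [:: 0; 9]); (2, [:: 1; 2]); (2, [:: 1; 3]); (2, [:: 1; 4]);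
   (2, [:: 1; 5]); (2, [:: 1; 6]); (2, [:: 1; 7]); (2, [:: 1; 8]); (2, [:: 1; 9]);
   (2, [:: 2; 3]); (2, [:: 2; 5]); (2, [:: 2; 6]); (2, [:: 2; 7]); (2, [:: 2; 8]);
   (2, [:: 2; 9]); (2, [:: 3; 6]); (2, [:: 3; 8]); (2, [:: 3; 9]); (2, [:: 4; 5]);
   (2, [:: 4; 6]); (2, [:: 4; 7]); (2, [:: 4; 8]); (2, [:: 4; 9]); (2, [:: 5; 6]);
   (2, [:: 5; 7]); (2, [:: 5; 8]); (2, [:: 5; 9]); (2, [:: 6; 8]); (2, [:: 6; 9]);
   (2, [:: 7; 8]); (3, [:: 0; 1]); (3, [:: 0; 2]); (3, [:: 0; 3]); (3, [:: 0; 4]);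
   (3, [:: 0; 5]); (3, [:: 0; 6]); (3, [:: 0; 7]); (3, [:: 0; 8]); (3, [:: 1; 2]);
   (3, [:: 1; 3]); (3, [:: 1; 4]); (3, [:: 1; 5]); (3, [:: 1; 6]); (3, [:: 1; 7]);
   (3, [:: 1; 8]); (3, [:: 2; 5]); (3, [:: 2; 6]); (3, [:: 2; 7]); (3, [:: 2; 8]);
   (3, [:: 3; 6]); (3, [:: 3; 8]); (3, [:: 4; 5]); (3, [:: 4; 6]); (3, [:: 4; 7]);
   (3, [:: 4; 8]); (3, [:: 5; 7]); (3, [:: 5; 8]); (3, [:: 6; 8]); (4, [:: 0; 1]);
   (4, [:: 0; 2]); (4, [:: 0; 4]); (4, [:: 0; 5]); (4, [:: 0; 7]); (4, [:: 1; 2]);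
   (4, [:: 1; 4]); (4, [:: 1; 5]); (4, [:: 1; 7]); (4, [:: 2; 5]); (4, [:: 2; 7]);
   (4, [:: 4; 5]); (4, [:: 4; 7]); (4, [:: 5; 7]); (0, [:: 0; 1; 2]); (0, [:: 0; 1; 3]);
   (0, [:: 0; 1; 4]); (0, [:: 0; 1; 5]); (0, [:: 0; 1; 6]); (0, [:: 0; 1; 7]);
   (0, [:: 0; 1; 8]); (0, [:: 0; 1; 9]); (0, [:: 0; 2; 3]); (0, [:: 0; 2; 5]);
   (0, [:: 0; 2; 6]); (0, [:: 0; 2; 7]); (0, [:: 0; 2; 8]); (0, [:: 0; 2; 9]);
   (0, [:: 0; 3; 6]); (0, [:: 0; 3; 8]); (0, [:: 0; 3; 9]); (0, [:: 0; 4; 5]);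
   (0, [:: 0; 4; 6]); (0, [:: 0; 4; 7]); (0, [:: 0; 4; 8]); (0, [:: 0; 4; 9]);
   (0, [:: 0; 5; 6]); (0, [:: 0; 5; 7]); (0, [:: 0; 5; 8]); (0, [:: 0; 5; 9]);
   (0, [:: 0; 6; 8]); (0, [:: 0; 6; 9]); (0, [:: 0; 7; 8]); (0, [:: 0; 7; 9]);
   (0, [:: 0; 8; 9]); (0, [:: 1; 2; 3]); (0, [:: 1; 2; 6]); (0, [:: 1; 2; 7]);
   (0, [:: 1; 2; 8]); (0, [:: 1; 2; 9]); (0, [:: 1; 3; 8]); (0, [:: 1; 3; 9]);
   (0, [:: 1; 4; 7]); (0, [:: 1; 4; 8]); (0, [:: 1; 4; 9]); (0, [:: 1; 5; 6]);
   (0, [:: 1; 5; 7]); (0, [:: 1; 5; 8]); (0, [:: 1; 5; 9]); (0, [:: 1; 6; 8]);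
   (0, [:: 1; 6; 9]); (0, [:: 1; 7; 8]); (0, [:: 1; 7; 9]); (0, [:: 1; 8; 9]);
   (0, [:: 2; 3; 9]); (0, [:: 2; 5; 7]); (0, [:: 2; 5; 8]); (0, [:: 2; 5; 9]);
   (0, [:: 2; 6; 9]); (0, [:: 2; 7; 9]); (0, [:: 2; 8; 9]); (0, [:: 3; 6; 8]);
   (0, [:: 3; 6; 9]); (0, [:: 3; 8; 9]); (0, [:: 4; 5; 6]); (0, [:: 4; 5; 7]);
   (0, [:: 4; 5; 8]); (0, [:: 4; 5; 9]); (0, [:: 4; 6; 8]); (0, [:: 4; 6; 9]);
   (0, [:: 4; 7; 8]); (0, [:: 4; 7; 9]); (0, [:: 4; 8; 9]); (0, [:: 5; 6; 9]);
   (0, [:: 5; 7; 9]); (0, [:: 5; 8; 9]); (0, [:: 6; 8; 9]); (0, [:: 7; 8; 9]);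
   (1, [:: 0; 1; 2]); (1, [:: 0; 1; 3]); (1, [:: 0; 1; 4]); (1, [:: 0; 1; 5]);
   (1, [:: 0; 1; 6]); (1, [:: 0; 1; 7]); (1, [:: 0; 1; 8]); (1, [:: 0; 1; 9]);
   (1, [:: 0; 2; 3]); (1, [:: 0; 2; 5]); (1, [:: 0; 2; 6]); (1, [:: 0; 2; 7]);
   (1, [:: 0; 2; 8]); (1, [:: 0; 2; 9]); (1, [:: 0; 3; 6]); (1, [:: 0; 3; 8]);
   (1, [:: 0; 3; 9]); (1, [:: 0; 4; 5]); (1, [:: 0; 4; 6]); (1, [:: 0; 4; 7]);
   (1, [:: 0; 4; 8]); (1, [:: 0; 4; 9]); (1, [:: 0; 5; 6]); (1, [:: 0; 5; 7]);
   (1, [:: 0; 5; 8]); (1, [:: 0; 5; 9]); (1, [:: 0; 6; 8]); (1, [:: 0; 6; 9]);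
   (1, [:: 0; 7; 8]); (1, [:: 0; 7; 9]); (1, [:: 0; 8; 9]); (1, [:: 1; 2; 3]);
   (1, [:: 1; 2; 7]); (1, [:: 1; 2; 8]); (1, [:: 1; 2; 9]); (1, [:: 1; 3; 8]);
   (1, [:: 1; 3; 9]); (1, [:: 1; 4; 7]); (1, [:: 1; 4; 8]); (1, [:: 1; 4; 9]);
   (1, [:: 1; 5; 6]); (1, [:: 1; 5; 7]); (1, [:: 1; 5; 8]); (1, [:: 1; 5; 9]);
   (1, [:: 1; 6; 8]); (1, [:: 1; 6; 9]); (1, [:: 1; 7; 8]); (1, [:: 1; 7; 9]);
   (1, [:: 1; 8; 9]); (1, [:: 2; 3; 9]); (1, [:: 2; 5; 7]); (1, [:: 2; 5; 8]);
   (1, [:: 2; 5; 9]); (1, [:: 2; 6; 9]); (1, [:: 2; 7; 9]); (1, [:: 2; 8; 9]);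
   (1, [:: 3; 6; 8]); (1, [:: 3; 6; 9]); (1, [:: 3; 8; 9]); (1, [:: 4; 5; 7]);
   (1, [:: 4; 5; 8]); (1, [:: 4; 5; 9]); (1, [:: 4; 6; 8]); (1, [:: 4; 6; 9]);
   (1, [:: 5; 6; 9]); (1, [:: 7; 8; 9]); (2, [:: 0; 1; 2]); (2, [:: 0; 1; 3]);
   (2, [:: 0; 1; 4]); (2, [:: 0; 1; 5]); (2, [:: 0; 1; 6]); (2, [:: 0; 1; 7]);
   (2, [:: 0; 1; 8]); (2, [:: 0; 1; 9]); (2, [:: 0; 2; 3]); (2, [:: 0; 2; 5]);
   (2, [:: 0; 2; 6]); (2, [:: 0; 2; 7]); (2, [:: 0; 2; 8]); (2, [:: 0; 2; 9]);
   (2, [:: 0; 3; 6]); (2, [:: 0; 3; 8]); (2, [:: 0; 3; 9]); (2, [:: 0; 4; 5]);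
   (2, [:: 0; 4; 6]); (2, [:: 0; 4; 7]); (2, [:: 0; 4; 8]); (2, [:: 0; 4; 9]);
   (2, [:: 0; 5; 6]); (2, [:: 0; 5; 7]); (2, [:: 0; 5; 8]); (2, [:: 0; 5; 9]);
   (2, [:: 0; 6; 8]); (2, [:: 0; 6; 9]); (2, [:: 0; 7; 8]); (2, [:: 1; 2; 7]);
   (2, [:: 1; 2; 8]); (2, [:: 1; 3; 8]); (2, [:: 1; 4; 7]); (2, [:: 1; 4; 8]);
   (2, [:: 1; 4; 9]); (2, [:: 1; 5; 7]); (2, [:: 1; 5; 8]); (2, [:: 1; 5; 9]);
   (2, [:: 1; 6; 8]); (2, [:: 1; 6; 9]); (2, [:: 2; 3; 9]); (2, [:: 2; 5; 7]);
   (2, [:: 2; 5; 8]); (2, [:: 2; 5; 9]); (2, [:: 2; 6; 9]); (2, [:: 3; 6; 8]);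
   (2, [:: 3; 6; 9]); (2, [:: 4; 5; 7]); (2, [:: 4; 5; 8]); (2, [:: 4; 6; 8]);
   (2, [:: 5; 6; 9]); (3, [:: 0; 1; 2]); (3, [:: 0; 1; 3]); (3, [:: 0; 1; 4]);
   (3, [:: 0; 1; 5]); (3, [:: 0; 1; 6]); (3, [:: 0; 1; 7]); (3, [:: 0; 1; 8]);
   (3, [:: 0; 2; 5]); (3, [:: 0; 2; 7]); (3, [:: 0; 2; 8]); (3, [:: 0; 3; 6]);
   (3, [:: 0; 3; 8]); (3, [:: 0; 4; 5]); (3, [:: 0; 4; 6]); (3, [:: 0; 4; 7]);
   (3, [:: 0; 4; 8]); (3, [:: 0; 5; 7]); (3, [:: 0; 5; 8]); (3, [:: 0; 6; 8]);
   (3, [:: 1; 2; 7]); (3, [:: 1; 3; 8]); (3, [:: 1; 4; 7]); (3, [:: 1; 4; 8]);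
   (3, [:: 1; 5; 7]); (3, [:: 1; 5; 8]); (3, [:: 1; 6; 8]); (3, [:: 2; 5; 7]);
   (3, [:: 3; 6; 8]); (3, [:: 4; 5; 7]); (3, [:: 4; 6; 8]); (4, [:: 0; 1; 2]);
   (4, [:: 0; 1; 4]); (4, [:: 0; 1; 5]); (4, [:: 0; 1; 7]); (4, [:: 0; 2; 5]);
   (4, [:: 0; 2; 7]); (4, [:: 0; 4; 5]); (4, [:: 0; 4; 7]); (4, [:: 0; 5; 7]);
   (4, [:: 1; 2; 7]); (4, [:: 1; 4; 7]); (4, [:: 1; 5; 7]); (4, [:: 2; 5; 7]);
   (4, [:: 4; 5; 7]); (0, [:: 0; 1; 5; 7]); (0, [:: 0; 1; 5; 8]); (0, [:: 0; 1; 5; 9]);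
   (0, [:: 0; 1; 6; 8]); (0, [:: 0; 1; 6; 9]); (0, [:: 0; 1; 7; 9]);
   (0, [:: 0; 1; 8; 9]); (0, [:: 0; 2; 6; 9]); (0, [:: 0; 2; 8; 9]);
   (0, [:: 1; 2; 8; 9]); (0, [:: 4; 5; 8; 9]); (1, [:: 0; 1; 5; 7]);
   (1, [:: 0; 1; 5; 8]); (1, [:: 0; 1; 5; 9]); (1, [:: 0; 1; 6; 8]);
   (1, [:: 0; 1; 6; 9]); (1, [:: 0; 2; 6; 9]); (1, [:: 1; 2; 8; 9]);
   (2, [:: 0; 1; 5; 7]); (2, [:: 0; 1; 5; 8]); (2, [:: 0; 1; 6; 8]);
   (2, [:: 0; 2; 6; 9]); (3, [:: 0; 1; 5; 7]); (3, [:: 0; 1; 6; 8]);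
   (4, [:: 0; 1; 5; 7])].

(* Found by linear algebra: sums of [Sq^B(x^a)] in degree [64], each to be used
   up to the listed permutations of the variables. *)
Definition hit64_0 : seq (nat * seq nat) :=
  [:: (1, [:: 17; 5; 7; 13; 21]); (1, [:: 17; 5; 7; 21; 13]); (1, [:: 17; 5; 21; 7; 13]);
   (1, [:: 25; 5; 7; 13; 13]); (2, [:: 14; 3; 7; 13; 25]); (2, [:: 14; 3; 7; 17; 21]);
   (2, [:: 14; 3; 7; 21; 17]); (2, [:: 14; 3; 7; 25; 13]); (2, [:: 14; 3; 21; 7; 17]);
   (2, [:: 14; 3; 25; 7; 13]); (2, [:: 14; 5; 19; 11; 13]); (2, [:: 14; 9; 7; 13; 19]);
   (2, [:: 14; 9; 7; 19; 13]); (2, [:: 14; 9; 19; 7; 13]); (2, [:: 17; 3; 7; 13; 22]);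
   (2, [:: 17; 3; 7; 14; 21]); (2, [:: 17; 3; 7; 21; 14]); (2, [:: 17; 3; 7; 22; 13]);
   (2, [:: 17; 3; 21; 7; 14]); (2, [:: 17; 3; 22; 7; 13]); (2, [:: 17; 6; 7; 11; 21]);
   (2, [:: 17; 6; 7; 19; 13]); (2, [:: 17; 6; 19; 7; 13]); (2, [:: 18; 9; 11; 11; 13]);
   (2, [:: 19; 8; 11; 11; 13]); (2, [:: 19; 10; 9; 11; 13]); (2, [:: 22; 3; 7; 13; 17]);
   (2, [:: 22; 3; 7; 17; 13]); (2, [:: 22; 9; 7; 11; 13]); (2, [:: 25; 3; 7; 13; 14]);
   (2, [:: 25; 3; 7; 14; 13]); (2, [:: 25; 6; 7; 11; 13]); (2, [:: 26; 3; 9; 11; 13]);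
   (4, [:: 14; 3; 5; 13; 25]); (4, [:: 14; 3; 5; 25; 13]); (4, [:: 14; 3; 21; 9; 13]);
   (4, [:: 14; 5; 7; 13; 21]); (4, [:: 14; 5; 7; 21; 13]); (4, [:: 14; 5; 9; 13; 19]);
   (4, [:: 14; 5; 9; 19; 13]); (4, [:: 14; 5; 11; 13; 17]); (4, [:: 14; 5; 11; 17; 13]);
   (4, [:: 14; 5; 19; 9; 13]); (4, [:: 14; 5; 21; 7; 13]); (4, [:: 18; 5; 13; 11; 13]);
   (4, [:: 19; 4; 11; 13; 13]); (4, [:: 19; 4; 13; 11; 13]); (4, [:: 19; 6; 9; 13; 13]);
   (4, [:: 19; 12; 5; 11; 13]); (4, [:: 20; 9; 7; 11; 13]); (4, [:: 21; 3; 9; 13; 14]);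
   (4, [:: 21; 3; 9; 14; 13]); (4, [:: 21; 6; 9; 11; 13]); (4, [:: 21; 8; 7; 11; 13]);
   (4, [:: 22; 3; 9; 13; 13]); (4, [:: 22; 5; 7; 13; 13]); (4, [:: 22; 5; 9; 11; 13]);
   (4, [:: 28; 3; 5; 11; 13]); (8, [:: 14; 5; 11; 13; 13])].
Definition hit64_0_perms : seq (seq nat) :=
  [:: [:: 0; 1; 2; 3; 4]; [:: 0; 1; 3; 2; 4]; [:: 0; 1; 4; 2; 3]; [:: 0; 2; 1; 3; 4];
   [:: 0; 2; 3; 1; 4]; [:: 0; 2; 4; 1; 3]; [:: 0; 3; 1; 2; 4]; [:: 0; 3; 4; 1; 2];
   [:: 0; 4; 1; 2; 3]; [:: 1; 0; 2; 3; 4]; [:: 1; 0; 3; 2; 4]; [:: 1; 0; 4; 2; 3];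
   [:: 1; 2; 0; 3; 4]; [:: 2; 0; 1; 3; 4]].

Definition hit64_1 : seq (nat * seq nat) :=
  [:: (2, [:: 14; 7; 9; 15; 17]); (4, [:: 14; 5; 9; 15; 17])].
Definition hit64_1_perms : seq (seq nat) :=
  [:: [:: 0; 1; 2; 3; 4]; [:: 0; 1; 2; 4; 3]; [:: 0; 1; 3; 2; 4]; [:: 0; 2; 3; 1; 4];
   [:: 1; 2; 3; 0; 4]].

Definition hit64_2 : seq (nat * seq nat) :=
  [:: (1, [:: 3; 3; 31; 9; 17]); (2, [:: 3; 5; 31; 6; 17]); (2, [:: 3; 5; 31; 9; 14]);
   (4, [:: 3; 3; 31; 6; 17]); (4, [:: 3; 3; 31; 9; 14]); (8, [:: 3; 3; 11; 17; 22]);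
   (8, [:: 3; 3; 27; 6; 17]); (16, [:: 3; 3; 19; 9; 14])].
Definition hit64_2_perms : seq (seq nat) :=
  [:: [:: 0; 1; 2; 3; 4]; [:: 0; 1; 3; 2; 4]; [:: 0; 1; 4; 2; 3]; [:: 0; 2; 1; 3; 4];
   [:: 1; 2; 0; 3; 4]].

Definition hit64_3 : seq (nat * seq nat) :=
  [:: (1, [:: 5; 5; 5; 23; 25]); (2, [:: 3; 5; 5; 23; 26]); (2, [:: 3; 5; 6; 23; 25]);
   (2, [:: 3; 6; 5; 23; 25]); (2, [:: 6; 3; 5; 23; 25]); (4, [:: 3; 5; 9; 15; 28]);
   (8, [:: 3; 5; 5; 15; 28]); (16, [:: 3; 5; 5; 15; 20])].
Definition hit64_3_perms : seq (seq nat) :=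
  [:: [:: 0; 1; 2; 3; 4]; [:: 0; 1; 3; 2; 4]; [:: 0; 1; 4; 2; 3]; [:: 0; 2; 3; 1; 4];
   [:: 0; 2; 4; 1; 3]; [:: 0; 3; 4; 1; 2]; [:: 1; 2; 3; 0; 4]; [:: 1; 2; 4; 0; 3];
   [:: 1; 3; 4; 0; 2]; [:: 2; 3; 4; 0; 1]].

Definition hit64_4 : seq (nat * seq nat) :=
  [:: (1, [:: 5; 5; 7; 21; 25]); (2, [:: 3; 5; 7; 21; 26]); (2, [:: 3; 5; 7; 22; 25]);
   (2, [:: 3; 6; 7; 21; 25]); (2, [:: 6; 3; 7; 21; 25]); (4, [:: 3; 5; 11; 13; 28]);
   (8, [:: 3; 5; 7; 13; 28]); (16, [:: 3; 5; 7; 13; 20])].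
Definition hit64_4_perms : seq (seq nat) :=
  [:: [:: 0; 1; 2; 3; 4]].

(** The exponent in place [k] moves to the variable number [g_k]. *)
Definition permute (g : seq nat) (e : seq nat) : seq nat :=
  [seq nth 0 e (index j g) | j <- iota 0 5].

(** There are 14 + 5 + 5 + 10 + 1 = 35 certificates. *)
Definition hit64 : seq (seq (nat * seq nat)) :=
  flatten [seq [seq [seq (x.1, permute g x.2) | x <- p.1] | g <- p.2]
          | p <- [:: (hit64_0, hit64_0_perms); (hit64_1, hit64_1_perms);
                     (hit64_2, hit64_2_perms); (hit64_3, hit64_3_perms);
                     (hit64_4, hit64_4_perms)]].

Fixpoint letters_of (s : nat) (e : seq nat) : seq nat :=
  if s is s'.+1 then
    find (fun x => map odd e == bits x) (iota 0 10) :: letters_of s' (map half e)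
  else [::].
(** Inverse of [wexp] on monomials of weight [wvec s]: the variable with even exponent is [x_i], and
    each higher layer of digits is a letter. *)
Definition decode s (e : seq nat) : nat * seq nat :=
  (find (fun x => ~~ odd x) e, letters_of s (map half e)).

Definition hit64_rels : seq rel :=
  [seq map (decode 4) (certeval (wvec 4) c) | c <- hit64].

Definition hit64_check : bool :=
  all (certwf 7 5 64) hit64 &&
  all (fun c => all (fun e => let w := decode 4 e in
    [&& w.1 < 5, all (ltn^~ 10) w.2 & wexp w.1 w.2 == e]) (certeval (wvec 4) c)) hit64.

Fixpoint msets (n : nat) : seq (seq nat) :=
  if n is n'.+1 then
    flatten [seq [seq x :: t | t <- msets n' & all (leq x) t] | x <- iota 0 10]
  else [:: [::]].

Fixpoint subsets (n : nat) : seq (seq nat) :=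
  if n is n'.+1 then
    flatten [seq [seq x :: t | t <- subsets n' & all (ltn x) t] | x <- iota 0 10]
  else [:: [::]].

(** Base 16 with digits [x + 1] and a leading 1. No digit is zero, so for entries below 15 the
    length of the list can be recovered too. *)
Fixpoint encode (w : seq nat) : positive :=
  if w is x :: w' then (16 * encode w' + Pos.of_succ_nat x)%positive else 1%positive.

Definition mcode (i : nat) (u : seq nat) : positive := encode (i :: sort leq u).
Definition mrow (r : rel) (t : seq nat) : seq positive :=
  [seq mcode y.1 (y.2 ++ t) | y <- r].

Definition pad s (u : seq nat) := u ++ nseq (s - size u) (head 0 u).

(* Putting the basis first keeps the elimination sparse. *)
Definition word4_rows : seq (seq positive) :=
  [seq [:: mcode b.1 (pad 4 b.2)] | b <- basis] ++
  flatten [seq [seq mrow r.2 t | t <- msets (4 - r.1)] | r <- rels] ++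
  [seq mrow r [::] | r <- hit64_rels].

Definition word4_targets : seq (seq positive) :=
  [seq [:: mcode i u] | u <- msets 4, i <- iota 0 5].

(** Relations among words with [i = 0] only; [rels_shift] carries them to any other [i]. With five
    letters they imply [SST = STT] also for disjoint [S] and [T]. *)
Definition square_rows : seq (seq positive) :=
  flatten [seq [seq mrow r.2 t | t <- msets (5 - r.1)]
          | r <- rels & all (fun y => y.1 == 0) r.2].

Definition square_targets : seq (seq positive) :=
  [seq [:: mcode 0 [:: p.1, p.1, p.2 & t]; mcode 0 [:: p.1, p.2, p.2 & t]]
  | p <- letter_pairs,
    t <- msets 2].

Definition supp (u : seq nat) := [seq x <- iota 0 10 | x \in u].
Definition scode (i : nat) (u : seq nat) : positive := encode (i :: supp u).
Definition srow (r : rel) (t : seq nat) : seq positive :=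
  [seq scode y.1 (y.2 ++ t) | y <- r].

(** Words are replaced by their sets of letters. On sets [adj_rels] become trivial and [dpl_rels]
    become Pluecker relations, whence the bound [r.1 < 3]. The context [t] is nonempty because
    [Phi_rel] pads it by repeating one of its own letters. *)
Definition support_rows : seq (seq positive) :=
  [seq [:: scode b.1 b.2] | b <- basis] ++
  flatten [seq [seq srow r.2 t | t <- flatten [seq subsets n | n <- iota 1 (5 - r.1)]]
          | r <- rels & r.1 < 3].

Definition support_targets : seq (seq positive) :=
  [seq [:: scode i u] | u <- flatten [seq subsets n | n <- iota 1 5], i <- iota 0 5].

Definition basis_check : bool :=
  all (fun b => [&& b.1 < 5, all (ltn^~ 10) b.2 & 0 < size b.2 < 5]) basis.

(** Coefficient of the squarefree monomial [t^eps] in the product of the linear forms with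
    coefficients [cols], expanded along the first form. When there are as many forms as ones in
    [eps], this is a minor modulo 2. *)
Fixpoint lcoef (cols : seq (seq bool)) (eps : seq bool) : bool :=
  if cols is col :: cols' then
    foldr addb false
      [seq [&& nth false col r, nth false eps r & lcoef cols' (set_nth false eps r false)]
      | r <- iota 0 4]
  else ~~ has id eps.

Definition column (vs : seq (seq bool)) (j : nat) : seq bool := [seq nth false v j | v <- vs].
Definition columns vs := map (column vs) (iota 0 5).

Definition top_coef vs i := lcoef (mask (cobits i) (columns vs)) [:: true; true; true; true].
Definition plane_coef vs x := lcoef (mask (bits x) (columns vs)) [:: true; true; false; false].
Definition word_coef vs i u := top_coef vs i && all (plane_coef vs) u.

Fixpoint bool_seqs (m : nat) : seq (seq bool) :=
  if m is m'.+1 then [seq b :: t | b <- [:: false; true], t <- bool_seqs m'] else [:: [::]].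

Definition unit_row j := [seq l == j | l <- iota 0 5].

(* The columns of the matrix [vs] are the linear forms substituted for the five
   variables.  The first two rows are the reduced row echelon basis of a plane
   of [F_2^5]; the last two are unit vectors at two of the three non-pivots:
   [155 * 3 = 465] choices. *)
Definition functionals : seq (seq (seq bool)) :=
  flatten [seq let a := find id p.1 in let b := find id p.2 in
    [seq [:: p.1; p.2; unit_row q.1; unit_row q.2]
    | q <- pairs & [&& q.1 != a, q.1 != b, q.2 != a & q.2 != b]]
  | p <- [seq (v, v') | v <- bool_seqs 5, v' <- bool_seqs 5]
      & [&& find id p.1 < find id p.2, find id p.2 < 5 & ~~ nth false p.1 (find id p.2)]].

(** One row per functional, listing the basis words on which it is nonzero. That the rows span all
    unit vectors says that a combination of basis words killed by all functionals is zero. *)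
Definition lower_rows : seq (seq positive) :=
  [seq let top := [seq top_coef vs i | i <- iota 0 5] in
       let pl := [seq plane_coef vs x | x <- iota 0 10] in
       [seq Pos.of_succ_nat p.1
       | p <- zip (iota 0 465) basis
         & nth false top p.2.1 && all (nth false pl) p.2.2]
  | vs <- rev functionals].

Definition lower_targets : seq (seq positive) := [seq [:: Pos.of_succ_nat j] | j <- iota 0 465].

Lemma comm_checked : comm_check. Proof. by vm_compute. Qed.
Lemma rels_checked : rels_check. Proof. by vm_compute. Qed.
Lemma hit64_checked : hit64_check. Proof. by vm_compute. Qed.

Lemma word4_spanned : spanned word4_rows word4_targets. Proof. by vm_compute. Qed.
Lemma square_spanned : spanned square_rows square_targets. Proof. by vm_compute. Qed.
Lemma support_spanned : spanned support_rows support_targets. Proof. by vm_compute. Qed.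
Lemma basis_checked : basis_check. Proof. by vm_compute. Qed.

Lemma rels_shift_checked :
  all (fun r => all (fun y => y.1 == 0) r.2 ==>
    all (fun i => (r.1, [seq (i, y.2) | y <- r.2]) \in rels) (iota 0 5)) rels.
Proof. by vm_compute. Qed.

Lemma rels_bound_checked : all (fun r => r.1 <= 3) rels.
Proof. by vm_compute. Qed.

Lemma lower_spanned : spanned lower_rows lower_targets.
Proof. by vm_compute. Qed.

Lemma size_basis : size basis = 465. Proof. by vm_compute. Qed.

(* The variable [x_i] is missing from [\prod_(j != i) x_j]. *)
Definition positive_word (b : nat * seq nat) : bool := has (in_letter^~ b.1) b.2.

Lemma count_positive_basis : count positive_word basis = 290%N.
Proof. by vm_compute. Qed.

Opaque basis rels certified_rels hit64 hit64_rels functionals.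

(** * Functions on words *)

Notation letters := (all (ltn^~ 10)).

Lemma count_bits x : x < 10 -> count id (bits x) = 2.
Proof. by do 10![case: x => [//|x]]. Qed.

Lemma count_cobits i : i < 5 -> count id (cobits i) = 4.
Proof. by do 5![case: i => [//|i]]. Qed.

Lemma size_pexp u : size (pexp u) = 5.
Proof. by elim: u => //= x u IH; rewrite size_push ?IH. Qed.

Lemma size_wexp i u : size (wexp i u) = 5.
Proof. by rewrite size_push ?size_pexp. Qed.

Lemma sumn_pexp u : letters u -> sumn (pexp u) = pdeg (size u).
Proof.
elim: u => //= x u IH /andP[xl /IH E].
by rewrite sumn_push ?size_pexp // count_bits // E.
Qed.

Lemma push_tailadd X r e y : size X = size e -> size e = size y ->
  push X (tailadd r e y) = tailadd r.+1 (push X e) y.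
Proof.
rewrite /push /tailadd; elim: X e y => [|b X IH] [|x e] [|z y] //= [] sX [] sy.
by rewrite IH //; congr (_ :: _); rewrite expnS; lia.
Qed.

Lemma pexp_cat u t : pexp (u ++ t) = tailadd (size u) (pexp u) (pexp t).
Proof.
elim: u => [|x u IH] /=; last by rewrite IH push_tailadd ?size_pexp.
have := size_pexp t; rewrite /tailadd.
case: (pexp t) => [|a [|b [|c [|d [|e []]]]]] //= _.
by rewrite !add0n !mul1n.
Qed.

Lemma wexp_cat i u t : wexp i (u ++ t) = tailadd (size u).+1 (wexp i u) (pexp t).
Proof. by rewrite /wexp pexp_cat push_tailadd ?size_pexp. Qed.

Lemma pdeg_cat l m : pdeg (l + m) = pdeg l + 2 ^ l * pdeg m.
Proof. by elim: l => [|l IH]; rewrite ?add0n ?mul1n //= IH expnS; lia. Qed.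

Lemma wdegree_cat l m : wdegree (l + m) = wdegree l + 2 ^ l.+1 * pdeg m.
Proof. by rewrite /wdegree pdeg_cat expnS; lia. Qed.

Lemma nseqD (T : Type) m n (x : T) : nseq (m + n) x = nseq m x ++ nseq n x.
Proof. by elim: m => //= m ->. Qed.

Section Local.
Variable V : zmodType.
Hypothesis char2 : forall x : V, (x + x = 0)%R.

Lemma eq_char2 (x y : V) : (x + y = 0)%R -> x = y.
Proof. by move/(congr1 (GRing.add^~ y)); rewrite -GRing.addrA char2 GRing.addr0 GRing.add0r. Qed.

(** The prefix [p] is removed by [good_push] and the suffix [t] by [good_tail]. What remains
    concerns two letters and is settled by the certificates [comm_cert]. *)
Lemma pexp_comm (G : seq nat -> V) p x y t :
  letters (p ++ [:: x, y & t]) ->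
  good 5 (nseq (size p + (size t).+2) 2) (pdeg (size p + (size t).+2)) G ->
  G (pexp (p ++ [:: x, y & t])) = G (pexp (p ++ [:: y, x & t])).
Proof.
elim: p G => [|z p IH] G /=; last first.
  case/andP=> zl lets gd.
  by apply: (IH (G \o push (bits z))) => //; apply: good_push gd _ _; rewrite ?count_bits.
case/and3P=> xl yl tl gd.
have [->//|xy] := eqVneq x y.
have /good_tail : good 5 ([:: 2; 2] ++ nseq (size t) 2)
    (6 + 2 ^ 2 * sumn (pexp t)) G.
  rewrite sumn_pexp //; suff <- : pdeg (size t).+2 = 6 + 2 ^ 2 * pdeg (size t) by [].
  by rewrite /=; lia.
rewrite size_pexp => /(_ erefl) gd2.
move: comm_checked => /allP/(_ x); rewrite mem_iota => /(_ xl) /allP/(_ y).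
rewrite mem_iota => /(_ yl); rewrite (negPf xy) /= => /andP[wf pm].
change (G (pexp ([:: x; y] ++ t)) = G (pexp ([:: y; x] ++ t))); rewrite !pexp_cat.
have := cert_sum char2 gd2 wf; rewrite (perm_big _ pm) /= !big_cons big_nil GRing.addr0.
exact: eq_char2.
Qed.

(* A function on words [(i; u)] satisfying the relations between words that
   are visible on at most four consecutive weight levels. *)
Definition local s (phi : nat -> seq nat -> V) :=
  (forall i u v, i < 5 -> letters u -> size u = s -> perm_eq u v -> phi i u = phi i v) /\
  (forall r t, r \in rels -> letters t -> r.1 + size t = s ->
     (\sum_(y <- r.2) phi y.1 (y.2 ++ t) = 0)%R).

(** Selection sort: the first letter of [u] is brought to the front of [v] by adjacent swaps. The
    prefix [q] holds the letters already matched. *)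
Lemma adjacent_swap_perm (P : seq nat -> V) (s : nat) :
  (forall p x y t, letters (p ++ [:: x, y & t]) -> size (p ++ [:: x, y & t]) = s ->
    P (p ++ [:: x, y & t]) = P (p ++ [:: y, x & t])) ->
  forall u v, letters u -> size u = s -> perm_eq u v -> P u = P v.
Proof.
move=> swap u v lu su puv; rewrite -[u]cat0s -[v]cat0s.
have : letters ([::] ++ u) by [].
have : size ([::] ++ u) = s by [].
move: [::] => q; clear su lu.
elim: u v q puv => [|x u IH] v q puv su lu.
  by move/perm_size: puv; case: v.
have xv : x \in v by rewrite -(perm_mem puv) mem_head.
have [v1 [v2 Ev]] : exists v1 v2, v = v1 ++ x :: v2.
  by case/splitPr: xv => v1 v2; exists v1, v2.
have puv' : perm_eq u (v1 ++ v2).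
  rewrite -(perm_cons x); apply: perm_trans puv _.
  by rewrite Ev perm_sym -cat1s perm_catCA.
have -> : P (q ++ v) = P (q ++ x :: v1 ++ v2).
  have lv : letters (q ++ v).
    by move: lu; rewrite !all_cat (perm_all _ puv).
  have sv : size (q ++ v) = s by rewrite -su !size_cat (perm_size puv).
  move: lv sv; rewrite Ev; clear -swap.
  elim/last_ind: v1 v2 => [//|v1 z IHv] v2.
  rewrite cat_rcons => lv sv.
  rewrite catA swap -?catA //.
  rewrite IHv //; first by rewrite cat_rcons.
  - by move: lv; rewrite !all_cat /=; case: (z < 10); case: (x < 10).
  - by rewrite -sv !size_cat.
rewrite -![q ++ x :: _]cat_rcons; apply: IH => //.
- by rewrite cat_rcons.
- by rewrite cat_rcons.
Qed.

(** Each certificate lives on the lowest levels, and the remaining letters [t] ride along as a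
    factor that is a high power of two. *)
Lemma good_local s (F : seq nat -> V) : good 5 (wvec s) (wdegree s) F ->
  local s (fun i u => F (wexp i u)).
Proof.
move=> gd; split=> [i u v il|[l r] t rin tl /= lt].
  apply: (@adjacent_swap_perm (fun u => F (wexp i u)) s) => p x y t lp sp.
  rewrite -!/((F \o push (cobits i)) (pexp _)); apply: pexp_comm => //.
  have -> : size p + (size t).+2 = s by rewrite -sp size_cat.
  by apply: good_push gd _ _; rewrite ?count_cobits.
case/mapP: rin => -[[l' r'] c] cin [El Er]; subst l r s.
move: rels_checked => /allP/(_ _ cin) /= /and3P[wf /allP szr pm].
have sw : size (wvec l') = l'.+1 by rewrite /= size_nseq.
have /good_tail : good 5 (wvec l' ++ nseq (size t) 2)
    (wdegree l' + 2 ^ size (wvec l') * sumn (pexp t)) F.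
  by rewrite sumn_pexp // sw -wdegree_cat /wvec cat_cons -nseqD.
rewrite size_pexp => /(_ erefl); rewrite sw => gd2.
have := cert_sum char2 gd2 wf; rewrite (perm_big _ pm) /= big_map /= => sum0; rewrite -[RHS]sum0.
rewrite !big_seq; apply: eq_bigr => -[i u] /szr /= /and3P[_ /eqP su _].
by rewrite wexp_cat su.
Qed.
End Local.

(** * Codes of words *)

Lemma encode_cons x w :
  encode (x :: w) = (16 * encode w + Pos.of_succ_nat x)%positive.
Proof. by []. Qed.
Arguments encode : simpl never.

Lemma encode_inj u v : all (ltn^~ 15) u -> all (ltn^~ 15) v ->
  encode u = encode v -> u = v.
Proof.
elim: u v => [|x u IH] [|y v] //; rewrite ?encode_cons.
- by change (encode [::]) with 1%positive; lia.
- by change (encode [::]) with 1%positive; lia.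
move=> /andP[x15 u15] /andP[y15 v15] E; rewrite /= in x15 y15; rewrite (IH v) //; last by lia.
by congr (_ :: _); lia.
Qed.

Lemma letters15 u : letters u -> all (ltn^~ 15) u.
Proof. by apply: sub_all => x /=; lia. Qed.

Lemma msetsS n : msets n.+1 =
  flatten [seq [seq x :: t | t <- msets n & all (leq x) t] | x <- iota 0 10].
Proof. by []. Qed.

Lemma mem_msets n u : letters u -> sorted leq u -> size u = n -> u \in msets n.
Proof.
elim: n u => [|n IH] [|x u] // /andP[x10 lu].
rewrite msetsS => pth [su]; apply/flatten_mapP; exists x; first by rewrite mem_iota.
apply: map_f; rewrite mem_filter (order_path_min leq_trans pth) IH //.
exact: path_sorted pth.
Qed.

Lemma subsetsS n : subsets n.+1 =
  flatten [seq [seq x :: t | t <- subsets n & all (ltn x) t] | x <- iota 0 10].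
Proof. by []. Qed.

Lemma mem_subsets n u : letters u -> sorted ltn u -> size u = n -> u \in subsets n.
Proof.
elim: n u => [|n IH] [|x u] // /andP[x10 lu].
rewrite subsetsS => pth [su]; apply/flatten_mapP; exists x; first by rewrite mem_iota.
apply: map_f; rewrite mem_filter (order_path_min ltn_trans pth) IH //.
exact: path_sorted pth.
Qed.

Lemma msetsP n u : u \in msets n -> letters u /\ size u = n.
Proof.
elim: n u => [|n IH] u; first by rewrite inE => /eqP->.
rewrite msetsS => /flatten_mapP[x].
rewrite mem_iota => /andP[_ x10] /mapP[t].
by rewrite mem_filter => /andP[_ /IH[lt st]] -> /=; rewrite x10 lt st.
Qed.

Lemma subsetsP n u : u \in subsets n -> letters u /\ size u = n.
Proof.
elim: n u => [|n IH] u; first by rewrite inE => /eqP->.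
rewrite subsetsS => /flatten_mapP[x].
rewrite mem_iota => /andP[_ x10] /mapP[t].
by rewrite mem_filter => /andP[_ /IH[lt st]] -> /=; rewrite x10 lt st.
Qed.

Lemma rels_wf r : r \in rels ->
  forall y, y \in r.2 -> [/\ y.1 < 5, size y.2 = r.1 & letters y.2].
Proof.
case/mapP=> x xin -> y yin; have /allP/(_ x xin)/and3P[_ /allP/(_ y yin) + _] := rels_checked.
by case/and3P=> ? /eqP.
Qed.

Lemma rels_bound r : r \in rels -> r.1 <= 3.
Proof. by move/(allP rels_bound_checked). Qed.

Lemma size_letters_of s e : size (letters_of s e) = s.
Proof. by elim: s e => //= s IH e; rewrite IH. Qed.

Lemma hit64P c : c \in hit64 -> certwf 7 5 64 c /\
  forall e, e \in certeval (wvec 4) c ->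
    [/\ (decode 4 e).1 < 5, letters (decode 4 e).2 & wexp (decode 4 e).1 (decode 4 e).2 = e].
Proof.
case/andP: hit64_checked => /allP wf /allP dec cin; split; first exact: wf.
by move=> e /(allP (dec c cin)) /and3P[? ? /eqP].
Qed.

Lemma hit64_relsP r : r \in hit64_rels ->
  exists2 c, c \in hit64 & r = map (decode 4) (certeval (wvec 4) c).
Proof. by case/mapP=> c cin ->; exists c. Qed.

Lemma hit64_rels_wf r : r \in hit64_rels ->
  forall y, y \in r -> [/\ y.1 < 5, size y.2 = 4 & letters y.2].
Proof.
case/mapP=> c cin -> y /mapP[e ein ->]; have [_ /(_ e ein)[? ? _]] := hit64P cin.
by split; rewrite // size_letters_of.
Qed.

Lemma letters_sort u : letters (sort leq u) = letters u.
Proof. by apply: perm_all; rewrite perm_sort. Qed.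

Lemma mcode_perm i u v : perm_eq u v -> mcode i u = mcode i v.
Proof.
move=> uv; congr (encode (i :: _)); apply/perm_sortP => //.
- exact: leq_total.
- exact: leq_trans.
- exact: anti_leq.
Qed.

Lemma scodeE i u : scode i u = encode (i :: supp u).
Proof. by []. Qed.

Section Decode.
Variables (V : zmodType) (ws : seq (seq nat)) (g : seq nat -> V).
(** Carries a function on words to a function on codes, the form that [spannedP] expects; decoding
    is a search through the finite list [ws]. *)
Definition at_code (c : positive) : V := g (nth [::] ws (find (fun w => encode w == c) ws)).
Lemma at_codeE w : all (all (ltn^~ 15)) ws -> w \in ws -> at_code (encode w) = g w.
Proof.
move=> /allP ok win; rewrite /at_code.
have h : has (fun w' => encode w' == encode w) ws by apply/hasP; exists w.
congr g; apply: encode_inj; [by apply/ok/mem_nth; rewrite -has_find|exact: ok|].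
exact/eqP/(nth_find [::] h).
Qed.
End Decode.

(** * Words with four letters *)

Section Upper.
Variable V : zmodType.
Hypothesis char2 : forall x : V, (x + x = 0)%R.

Definition words n : seq (seq nat) := [seq i :: u | u <- msets n, i <- iota 0 5].

Lemma words15 n : all (all (ltn^~ 15)) (words n).
Proof.
apply/allP=> w /allpairsP[[u i]] [/msetsP[lu _]]; rewrite mem_iota => /andP[_ i5] ->.
by rewrite /= (leq_trans i5) //= letters15.
Qed.

Lemma mem_words n i u : i < 5 -> letters u -> size u = n -> i :: sort leq u \in words n.
Proof.
move=> i5 lu su; apply/allpairsP; exists (sort leq u, i); split=> //.
- by rewrite mem_msets ?letters_sort ?size_sort // sort_sorted //; apply: leq_total.
- by rewrite mem_iota.
Qed.

Section Multiset.
Variables (n : nat) (psi : nat -> seq nat -> V).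
Hypothesis psi_perm : forall i u v, i < 5 -> letters u -> size u = n -> perm_eq u v ->
  psi i u = psi i v.
Definition at_mcode := at_code (words n) (fun w => psi (head 0 w) (behead w)).

Lemma at_mcodeE i u : i < 5 -> letters u -> size u = n -> at_mcode (mcode i u) = psi i u.
Proof.
move=> i5 lu su; rewrite /at_mcode at_codeE ?words15 ?mem_words //=.
by apply: psi_perm; rewrite ?letters_sort ?size_sort ?perm_sort.
Qed.

Lemma at_mrow r t : r \in rels -> letters t -> r.1 + size t = n ->
  (\sum_(c <- mrow r.2 t) at_mcode c = \sum_(y <- r.2) psi y.1 (y.2 ++ t))%R.
Proof.
move=> rin lt st; rewrite big_map !big_seq; apply: eq_bigr => y /(rels_wf rin)[y5 sy ly].
by rewrite at_mcodeE // ?all_cat ?ly ?size_cat ?sy.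
Qed.
End Multiset.

(** A single elimination: [word4_spanned] writes each multiset of four letters through the
    relations, the 35 hit elements of degree 64 and the padded basis words. *)
Lemma local4_eq0 (phi : nat -> seq nat -> V) : local 4 phi ->
  (forall r, r \in hit64_rels -> (\sum_(y <- r) phi y.1 y.2 = 0)%R) ->
  (forall b, b \in basis -> phi b.1 (pad 4 b.2) = 0%R) ->
  forall i u, i < 5 -> letters u -> size u = 4 -> phi i u = 0%R.
Proof.
move=> [perm rel] hit0 b0 i u i5 lu su.
have codeE := at_mcodeE perm.
suff : (\sum_(c <- [:: mcode i u]) at_mcode 4 phi c = 0)%R.
  by rewrite big_cons big_nil GRing.addr0 codeE.
apply: (spannedP char2 word4_spanned); last first.
  apply/allpairsP; exists (sort leq u, i); split.
  - by rewrite mem_msets ?letters_sort ?size_sort // sort_sorted //; apply: leq_total.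
  - by rewrite mem_iota.
  by rewrite /= /mcode (sorted_sort leq_trans (sort_sorted leq_total u)).
move=> r; rewrite mem_cat => /orP[/mapP[b bin ->]|].
- rewrite big_cons big_nil GRing.addr0 codeE ?b0 //;
    have /allP/(_ b bin)/and3P[b5 lb /andP[s0 s5]] := basis_checked => //.
  + rewrite all_cat lb all_nseq /=; case: (b.2) lb s0 => //= x l /andP[->] //.
    by rewrite orbT.
  + by rewrite size_cat size_nseq; lia.
rewrite mem_cat => /orP[/flattenP[_ /mapP[q qin ->] /mapP[t tin ->]]|].
- have [lt st] := msetsP tin.
  have sz : q.1 + size t = 4 by rewrite st subnKC // (leq_trans (rels_bound qin)).
  by rewrite at_mrow ?rel.
- case/mapP=> q qin ->; rewrite big_map -[RHS](hit0 q qin) !big_seq.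
  by apply: eq_bigr => y /(hit64_rels_wf qin)[y5 sy ly]; rewrite cats0 codeE.
Qed.
End Upper.

Lemma rels_shift r i : r \in rels -> all (fun y => y.1 == 0) r.2 -> i < 5 ->
  (r.1, [seq (i, y.2) | y <- r.2]) \in rels.
Proof.
move=> /(allP rels_shift_checked) /implyP sh /sh /allP/(_ i).
by rewrite mem_iota => shi i5; apply: shi.
Qed.

Lemma perm_undup_cat (u : seq nat) : exists w, perm_eq u (undup u ++ w).
Proof.
elim: u => [|x u [w pw]] /=; first by exists [::].
case: ifP => _; last by exists w; rewrite /= perm_cons.
by exists (x :: w); rewrite perm_sym perm_catC /= perm_cons perm_catC perm_sym.
Qed.

Lemma mem_supp u x : letters u -> (x \in supp u) = (x \in u).
Proof.
move=> lu; rewrite mem_filter mem_iota /= add0n; case: (boolP (x \in u)) => // xu.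
exact: (allP lu).
Qed.

Lemma supp_sorted u : sorted ltn (supp u).
Proof. exact/(sorted_filter ltn_trans)/iota_ltn_sorted. Qed.

Lemma letters_supp u : letters (supp u).
Proof. by apply/allP=> x; rewrite mem_filter mem_iota => /and3P[]. Qed.

Lemma supp_supp u : supp (supp u) = supp u.
Proof.
apply: eq_in_filter => x; rewrite mem_iota => /andP[_ x10].
by rewrite mem_filter mem_iota leq0n x10 !andbT.
Qed.

Lemma size_supp u : letters u -> size (supp u) <= size u.
Proof.
move=> lu; apply: uniq_leq_size; first by rewrite filter_uniq ?iota_uniq.
by move=> x; rewrite mem_supp.
Qed.

Lemma supp_neq0 v : letters v -> v != [::] -> supp v != [::].
Proof.
move=> lv; apply: contra => /eqP E.
by case: v lv E => // x v lv E; have := mem_supp x lv; rewrite E mem_head.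
Qed.

Lemma supp_subsets v : letters v -> v != [::] -> size v <= 5 ->
  supp v \in flatten [seq subsets m | m <- iota 1 5].
Proof.
move=> lv v0 sv; apply/flattenP; exists (subsets (size (supp v))).
  apply: map_f; rewrite mem_iota; apply/andP; split.
    by rewrite lt0n size_eq0 supp_neq0.
  by rewrite add1n ltnS (leq_trans (size_supp lv)).
by apply: mem_subsets; [exact: letters_supp|exact: supp_sorted|].
Qed.

Definition swords : seq (seq nat) :=
  [seq j :: v | v <- flatten [seq subsets m | m <- iota 1 5], j <- iota 0 5].

Lemma swords15 : all (all (ltn^~ 15)) swords.
Proof.
apply/allP=> w /allpairsP[[v j]] [/flattenP[_ /mapP[m _ ->] /subsetsP[lv _]]].
rewrite mem_iota => /andP[_ j5] ->.
by apply/andP; split; [exact: (leq_trans j5)|exact: letters15].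
Qed.

Lemma mem_swords j v : j < 5 -> letters v -> v != [::] -> size v <= 5 ->
  j :: supp v \in swords.
Proof.
move=> j5 lv v0 sv; apply/allpairsP; exists (supp v, j).
by split; [exact: supp_subsets|rewrite mem_iota|].
Qed.

Opaque encode mcode scode at_mcode at_code subsets msets swords.

Lemma big_seq2 (V : nmodType) (I : Type) (f : I -> V) x y :
  (\sum_(c <- [:: x; y]) f c = f x + f y)%R.
Proof. by rewrite big_cons big_seq1. Qed.

Lemma mem_pad n u : u != [::] -> pad n u =i u.
Proof.
case: u => // x u _ y; rewrite /pad mem_cat mem_nseq /=.
case: eqP => [->|_]; last by rewrite andbF orbF.
by rewrite mem_head.
Qed.

Lemma size_pad n u : size u <= n -> size (pad n u) = n.
Proof. by move=> un; rewrite size_cat size_nseq; lia. Qed.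

Lemma letters_pad n u : u != [::] -> letters u -> letters (pad n u).
Proof. by move=> u0 lu; apply/allP=> x; rewrite mem_pad //; apply: (allP lu). Qed.

(** * Words with five or more letters *)

Section Large.
Variable V : zmodType.
Hypothesis char2 : forall x : V, (x + x = 0)%R.
Variables (s : nat) (phi : nat -> seq nat -> V).
Hypotheses (s5 : 4 < s) (loc : local s phi).

Let perm := loc.1.
Let rel := loc.2.

(** All but the first five letters are frozen in [t2], which leaves the five-letter computation
    [square_spanned]. *)
Lemma local_square_lt i x y t : i < 5 -> letters [:: x, y & t] -> x < y ->
  (size t).+3 = s -> phi i [:: x, x, y & t] = phi i [:: x, y, y & t].
Proof.
move=> i5 /and3P[lx ly lt] xy st.
have {}lx : x < 10 := lx.
have {}ly : y < 10 := ly.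
set t1 := take 2 t; set t2 := drop 2 t.
have lt1 : letters t1 by apply/allP=> z /mem_take; apply: (allP lt).
have lt2 : letters t2 by apply/allP=> z /mem_drop; apply: (allP lt).
have st1 : size t1 = 2 by rewrite size_takel //; lia.
have st2 : 5 + size t2 = s by rewrite size_drop; lia.
(* The computation is made with first entry 0; [psi] ignores that entry and puts the actual [i] in
   its place. *)
pose psi (_ : nat) u := phi i (u ++ t2).
have psi_perm j u v : j < 5 -> letters u -> size u = 5 -> perm_eq u v -> psi j u = psi j v.
  move=> _ lu su uv; apply: perm; rewrite ?all_cat ?lu ?size_cat ?su //.
  by rewrite perm_cat2r.
have codeE := at_mcodeE psi_perm.
pose a := [:: x, x, y & t1]; pose b := [:: x, y, y & t1].
have la : letters a by rewrite /= lx ly.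
have lb : letters b by rewrite /= lx ly.
have sa : size a = 5 by rewrite /= st1.
have sb : size b = 5 by rewrite /= st1.
suff : (\sum_(c <- [:: mcode 0 a; mcode 0 b]) at_mcode 5 psi c = 0)%R.
  by rewrite big_seq2 (codeE 0 a isT la sa) (codeE 0 b isT lb sb);
    move/(eq_char2 char2); rewrite /psi /a /b !cat_cons cat_take_drop.
apply: (spannedP char2 square_spanned); last first.
  apply/allpairsP; exists ((x, y), sort leq t1); split.
  - rewrite mem_filter; apply/andP; split; first exact: xy.
    apply/allpairsP; exists (x, y).
    by split; rewrite ?mem_iota.
  - by rewrite mem_msets ?letters_sort ?size_sort // sort_sorted //; apply: leq_total.
  by congr [:: _; _]; apply: mcode_perm; rewrite !perm_cons perm_sym perm_sort.
move=> r /flattenP[_ /mapP[q qin ->] /mapP[v vin ->]].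
move: qin; rewrite mem_filter => /andP[q0 qin].
have [lv sv] := msetsP vin.
have sz : q.1 + size v = 5 by rewrite sv subnKC // (leq_trans (rels_bound qin)).
rewrite (at_mrow psi_perm) //.
have := rel (rels_shift qin q0 i5) (t := v ++ t2); rewrite /= all_cat lv lt2 size_cat.
rewrite addnA sz big_map => /(_ isT st2) E; rewrite -[RHS]E.
by apply: eq_bigr => y' _; rewrite /psi catA.
Qed.

Lemma local_square i x y t : i < 5 -> letters [:: x, y & t] ->
  (size t).+3 = s -> phi i [:: x, x, y & t] = phi i [:: x, y, y & t].
Proof.
move=> i5 l st; case: (ltngtP x y) => [xy|yx|-> //]; first exact: local_square_lt.
have /and3P[lx ly lt] := l.
have {}lx : x < 10 := lx.
have {}ly : y < 10 := ly.
have P u v : perm_eq u v -> size u = s -> letters u -> phi i u = phi i v.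
  by move=> uv su lu; apply: perm.
rewrite (P _ [:: y, x, x & t]) /= ?lx ?ly //; last first.
  by rewrite perm_sym -[_ :: _]/([:: y] ++ [:: x; x] ++ t) perm_catCA.
rewrite -local_square_lt //= ?lx ?ly //; apply: P => //=; last by rewrite lx ly.
by rewrite -[_ :: _]/([:: y; y] ++ [:: x] ++ t) perm_catCA.
Qed.

(** With both letters present in [w], this is [xxy = xyy] after a permutation. It lets every
    repeated letter be traded for any letter that occurs. *)
Lemma local_replace i x y w : i < 5 -> letters w -> (size w).+1 = s ->
  x \in w -> y \in w -> phi i (x :: w) = phi i (y :: w).
Proof.
move=> i5 lw sw xw yw; have [->//|xy] := eqVneq x y.
have pw := perm_to_rem xw.
have yw' : y \in rem x w.
  by move: yw; rewrite (perm_mem pw) inE eq_sym (negPf xy).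
have pw' : perm_eq w [:: x, y & rem y (rem x w)].
  by apply: perm_trans pw _; rewrite perm_cons perm_to_rem.
have lw' : letters [:: x, y & rem y (rem x w)] by rewrite -(perm_all _ pw').
have sw' := perm_size pw'; rewrite /= in sw'.
have /and3P[lx ly lr] := lw'.
have -> : phi i (x :: w) = phi i [:: x, x, y & rem y (rem x w)].
  by apply: perm => //; rewrite ?perm_cons //= lw andbT.
have -> : phi i (y :: w) = phi i [:: x, y, y & rem y (rem x w)].
  apply: perm => //; first by rewrite /= lw andbT.
  apply: (@perm_trans _ [:: y, x, y & rem y (rem x w)]); first by rewrite perm_cons.
  by rewrite -[X in perm_eq X]/([:: y] ++ [:: x] ++ _) perm_catCA.
by apply: local_square => //; rewrite -sw sw'.
Qed.

Lemma local_fill i u q w z : i < 5 -> letters (u ++ q ++ w) ->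
  size (u ++ q ++ w) = s -> {subset w <= u} -> z \in u ->
  phi i (u ++ q ++ w) = phi i (u ++ q ++ nseq (size w) z).
Proof.
move=> i5; elim: w q => [//|x w IH] q luw suw sub zu.
have xu : x \in u by apply: sub; rewrite mem_head.
have mv y : perm_eq (u ++ q ++ y :: w) (y :: u ++ q ++ w).
  by rewrite -cat1s !catA -[X in perm_eq _ X]cat1s !catA perm_cat2r perm_catC catA.
have luw' : letters (u ++ q ++ w).
  by move: luw; rewrite (perm_all _ (mv x)) => /andP[].
have lx : letters [:: x] by move: luw; rewrite (perm_all _ (mv x)) => /andP[/= ->].
have lz : letters [:: z].
  by move: luw'; rewrite all_cat => /andP[/allP/(_ z zu) /= ->].
have sw : (size (u ++ q ++ w)).+1 = s by rewrite -suw (perm_size (mv x)).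
rewrite (perm i5 luw suw (mv x)) (@local_replace i x z) ?mem_cat ?xu ?zu //.
rewrite -(perm _ _ _ (mv z)) //.
- rewrite -[z :: w]cat1s [q ++ _]catA IH //.
  + by rewrite -catA /=; congr (phi i (u ++ q ++ _)).
  + by rewrite -!catA (perm_all _ (mv z)) /= luw' andbT; case/andP: lz.
  + by rewrite -!catA (perm_size (mv z)).
  + by move=> y yw; apply: sub; rewrite inE yw orbT.
- by rewrite (perm_all _ (mv z)) /= luw' andbT; case/andP: lz.
- by rewrite (perm_size (mv z)).
Qed.

(** Both words have the same normal form: their distinct letters, followed by copies of a single
    letter [z]. *)
Lemma local_supp i u v : i < 5 -> letters u -> size u = s -> size v = s -> u =i v ->
  phi i u = phi i v.
Proof.
move=> i5 lu su sv uv.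
have lv : letters v by apply/allP=> x; rewrite -uv; apply: (allP lu).
case: u su lu uv => [|z u]; first by rewrite /=; lia.
move: (z :: u) (mem_head z u) => {}u zu su lu uv.
have norm w : letters w -> size w = s -> u =i w ->
    phi i w = phi i (undup w ++ nseq (s - size (undup w)) z).
  move=> lw sw uw; have [t pt] := perm_undup_cat w.
  have st : size t = s - size (undup w) by rewrite -sw (perm_size pt) size_cat addKn.
  rewrite (perm i5 lw sw pt) -[t]cat0s (@local_fill i _ [::] t z) ?st //.
  - by rewrite -(perm_all _ pt).
  - by rewrite -(perm_size pt).
  - by move=> x xt; rewrite mem_undup (perm_mem pt) mem_cat xt orbT.
  - by rewrite mem_undup -uw.
have puv : perm_eq (undup u) (undup v).
  by apply: uniq_perm; rewrite ?undup_uniq // => x; rewrite !mem_undup.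
have lz : z < 10 by apply: (allP lu).
rewrite norm // [RHS]norm // -(perm_size puv); apply: perm => //.
- rewrite all_cat all_nseq /= lz orbT andbT.
  by apply/allP=> x; rewrite mem_undup; apply: (allP lu).
- by rewrite size_cat size_nseq subnKC // -su size_undup.
- by rewrite perm_cat2r.
Qed.

Let Phi i u := phi i (pad s u).

Lemma Phi_supp i u v : i < 5 -> letters u -> u != [::] -> size u <= s -> size v <= s ->
  u =i v -> Phi i u = Phi i v.
Proof.
move=> i5 lu u0 su sv uv.
have v0 : v != [::].
  by case: u u0 uv {lu su} => // x u _ /(_ x); rewrite mem_head; case: v {sv}.
by apply: local_supp; rewrite ?letters_pad ?size_pad // => x; rewrite !mem_pad.
Qed.

(** The relation is used with [t] padded inside itself. All its words then have the required length,
    and their sets of letters are unchanged. *)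
Lemma Phi_rel r t : r \in rels -> letters t -> t != [::] -> r.1 + size t <= s ->
  (\sum_(y <- r.2) Phi y.1 (y.2 ++ t) = 0)%R.
Proof.
move=> rin lt t0 st; pose t' := pad (s - r.1) t.
have := rel rin (t := t') (letters_pad _ t0 lt); rewrite size_pad; last by lia.
move=> E; rewrite -[RHS]E; last by lia.
rewrite !big_seq; apply: eq_bigr => y /(rels_wf rin)[y5 sy ly].
apply: local_supp => //.
- by rewrite letters_pad ?all_cat ?ly ?lt // -size_eq0 size_cat addn_eq0 negb_and !size_eq0 t0 orbT.
- by rewrite size_pad // size_cat sy.
- by rewrite size_cat sy size_pad; lia.
move=> x; rewrite mem_pad; last by rewrite -size_eq0 size_cat addn_eq0 negb_and !size_eq0 t0 orbT.
by rewrite mem_cat [RHS]mem_cat /t' mem_pad.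
Qed.

(** Induction on the number of distinct letters. Five of them form [W], the others [R] are carried
    along, and [support_spanned] expresses [W] through basis words, which have at most four
    letters. *)
Lemma local_large_eq0 : (forall b, b \in basis -> phi b.1 (pad s b.2) = 0%R) ->
  forall i u, i < 5 -> letters u -> size u = s -> phi i u = 0%R.
Proof.
move=> b0 i u i5 lu su.
suff Phi0 : forall n i U, i < 5 -> letters U -> uniq U -> 0 < size U <= s ->
    size U < n -> Phi i U = 0%R.
  have sz : size (undup u) <= s by rewrite -su size_undup.
  have n0 : undup u != [::].
    apply/eqP => E; case: u su {lu sz} E => [|x u] su E; first by rewrite /= in su; lia.
    by have := mem_undup (x :: u) x; rewrite E mem_head.
  have lu' : letters (undup u) by apply/allP=> x; rewrite mem_undup; apply: (allP lu).
  rewrite -(Phi0 (size (undup u)).+1 i (undup u)) ?undup_uniq ?sz ?andbT ?lt0n ?size_eq0 //.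
  by apply: local_supp => //; rewrite ?size_pad // => x; rewrite mem_pad // mem_undup.
elim=> [//|n IH] {u lu su i5}i U i5 lU uU /andP[U0 Us] Un.
set W := take 5 U; set R := drop 5 U.
have lW : letters W by apply/allP=> x /mem_take; apply: (allP lU).
have lR : letters R by apply/allP=> x /mem_drop; apply: (allP lU).
have UE : U = W ++ R by rewrite cat_take_drop.
have sW : size W <= 5 by rewrite size_take_min geq_minl.
have W0 : W != [::] by rewrite -size_eq0 size_take_min -lt0n leq_min U0.
have sR : 5 + size R <= s by rewrite size_drop -maxnE geq_max s5 Us.
pose g w := Phi (head 0 w) (behead w ++ R).
have codeE j v : j < 5 -> letters v -> v != [::] -> size v <= 5 ->
    at_code swords g (scode j v) = Phi j (v ++ R).
  move=> j5 lv v0 sv; rewrite scodeE (at_codeE _ swords15) ?mem_swords //.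
  apply: Phi_supp => //.
  - by rewrite all_cat letters_supp.
  - by rewrite -size_eq0 size_cat addn_eq0 negb_and size_eq0 supp_neq0.
  - by rewrite size_cat (leq_trans _ sR) // leq_add2r (leq_trans (size_supp lv)).
  - by rewrite size_cat (leq_trans _ sR) // leq_add2r.
  - by move=> x; rewrite !mem_cat mem_supp.
suff : (\sum_(c <- [:: scode i W]) at_code swords g c = 0)%R.
  by rewrite big_seq1 codeE // -UE.
apply: (spannedP char2 support_spanned); last first.
  apply/allpairsP; exists (supp W, i); split; [exact: supp_subsets|by rewrite mem_iota|].
  by congr [:: _]; rewrite !scodeE supp_supp.
move=> r; rewrite mem_cat => /orP[/mapP[b bin ->]|/flattenP[_ /mapP[q qin ->]]].
  have /and3P[b5 lb /andP[sb0 sb5]] := allP basis_checked b bin.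
  have bn : b.2 != [::] by rewrite -size_eq0 -lt0n.
  rewrite big_seq1 codeE //; last by rewrite -ltnS ltnW.
  (* With [R] empty this is the hypothesis on basis words. Otherwise [W] has exactly five letters,
     so replacing it by a basis word lowers the number of letters. *)
  have [R0|R0] := eqVneq R [::]; first by rewrite R0 cats0 /Phi b0.
  have lbR : letters (b.2 ++ R) by rewrite all_cat lb.
  have sbR : size (undup (b.2 ++ R)) < 5 + size R.
    by apply: leq_ltn_trans (size_undup _) _; rewrite size_cat ltn_add2r.
  have sU : size U = 5 + size R.
    rewrite size_drop -maxnE; apply/esym/maxn_idPr.
    by move: R0; rewrite -size_eq0 size_drop -lt0n subn_gt0; apply: ltnW.
  have uR : undup (b.2 ++ R) != [::].
    apply/eqP => E; have := mem_undup (b.2 ++ R); rewrite E => /(_ (head 0 b.2)).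
    by rewrite mem_cat; case: (b.2) bn => //= x l _; rewrite mem_head.
  rewrite (@Phi_supp _ _ (undup (b.2 ++ R))) //.
  - apply: IH => //.
    + by apply/allP=> x; rewrite mem_undup; apply: (allP lbR).
    + exact: undup_uniq.
    + by rewrite lt0n size_eq0 uR (leq_trans (ltnW sbR)).
    + by rewrite (leq_trans sbR) // -sU -ltnS.
  - by rewrite -size_eq0 size_cat addn_eq0 negb_and size_eq0 bn.
  - by rewrite size_cat (leq_trans _ sR) // leq_add2r ltnW.
  - by rewrite (leq_trans (ltnW sbR)).
  - by move=> x; rewrite mem_undup.
move: qin; rewrite mem_filter => /andP[q3 qin].
case/mapP=> t /flattenP[_ /mapP[m + ->] /subsetsP[lt st]] ->.
rewrite mem_iota => /andP[m1 m2].
have t0 : t != [::] by rewrite -size_eq0 st -lt0n.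
have sqt : q.1 + size t <= 5.
  rewrite st -leq_subRL; last by rewrite (leq_trans (rels_bound qin)).
  by move: m2; rewrite add1n ltnS.
have t0R : t ++ R != [::] by rewrite -size_eq0 size_cat addn_eq0 negb_and size_eq0 t0.
have lR' : letters (t ++ R) by rewrite all_cat lt.
have sR' : q.1 + size (t ++ R) <= s.
  by rewrite size_cat addnA (leq_trans _ sR) // leq_add2r.
rewrite -[RHS](Phi_rel qin lR' t0R sR') big_map !big_seq.
apply: eq_bigr => y /(rels_wf qin)[y5 sy ly].
rewrite codeE ?catA //.
- by rewrite all_cat ly.
- by rewrite -size_eq0 size_cat addn_eq0 negb_and !size_eq0 t0 orbT.
- by rewrite size_cat sy.
Qed.

End Large.

(** * Spanning *)

(** Lucas for the last binary digit, by applying Pascal's rule twice: modulo 2 the middle terms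
    cancel. *)
Lemma odd_bin_double (b c : bool) a m :
  odd 'C(b + a.*2, c + m.*2) = odd 'C(a, m) && (c ==> b).
Proof.
elim: a m => [|a IH] [|m].
- by case: b c => [] [].
- by rewrite bin0n /= bin_small //; case: b; case: c => /=; lia.
- clear IH; rewrite bin0 /= addn0; case: c => /=; last by rewrite bin0.
  by rewrite bin1 oddD odd_double addbF oddb.
have -> : b + a.+1.*2 = (b + a.*2).+2 by lia.
have -> : c + m.+1.*2 = (c + m.*2).+2 by lia.
rewrite !binS !oddD; have := IH m.+1; have -> : c + m.+1.*2 = (c + m.*2).+2 by lia.
by move=> ->; rewrite IH; do 3!case: (odd _); case: (c ==> b).
Qed.

(** * From lists of terms to binomial coefficients *)

Section Coefficients.
Local Open Scope ring_scope.
Notation F2 := 'F_2.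

Lemma F2_char (x : F2) : x + x = 0.
Proof. by rewrite -mulr2n -mulr_natr pchar_Zp ?mulr0. Qed.

Lemma F2_odd m : m%:R = (odd m)%:R :> F2.
Proof. by rewrite -{1}[m]odd_double_half natrD -addnn natrD F2_char addr0. Qed.

Lemma subm_coeff a m : \sum_(t <- subm a) (t == m)%:R = ('C(a, m))%:R :> F2.
Proof.
elim/ltn_ind: a m => a IH m.
have [->|a0] := posnP a.
  by rewrite big_seq1 bin0n eq_sym.
rewrite -[in RHS](odd_double_half a) -[in RHS](odd_double_half m) F2_odd odd_bin_double.
rewrite -[a in LHS]odd_double_half big_subm_double.
have Ha : (a./2 < a)%N by lia.
case: (boolP (odd m)) => om /=.
- rewrite big1; last by move=> t _; case: eqP => // E; exfalso; move: om; rewrite -E odd_double.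
  rewrite add0r; case: (odd a); last by rewrite andbF.
  rewrite andbT -F2_odd -IH //; apply: eq_bigr => t _; congr (_%:R); congr nat_of_bool.
  by apply/eqP/eqP => E; lia.
- rewrite andbT -F2_odd -IH // [X in _ + X](_ : _ = 0) ?addr0.
    apply: eq_bigr => t _; congr (_%:R); congr nat_of_bool.
    by apply/eqP/eqP => E; lia.
  case: (odd a) => //; rewrite big1 // => t _; case: eqP => // E.
  by exfalso; move: om; rewrite -E /= odd_double.
Qed.

Lemma subm_shift_coeff x y :
  \sum_(t <- subm x) ((x + t)%N == y)%:R = (('C(x, y - x) * (x <= y))%N)%:R :> F2.
Proof.
have [xy|yx] := leqP x y; last first.
  by rewrite muln0 big1 // => t _; case: eqP => //; lia.
rewrite muln1 -subm_coeff; apply: eq_bigr => t _; congr (_%:R); congr nat_of_bool.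
by apply/eqP/eqP; lia.
Qed.

Lemma sqall_coeff a u : size a = size u ->
  \sum_(c <- sqall a) (c == u)%:R =
  \prod_(p <- zip a u) (('C(p.1, p.2 - p.1) * (p.1 <= p.2))%N)%:R :> F2.
Proof.
elim: a u => [|x a IH] [|y u] //=; first by rewrite big_seq1 big_nil eqxx.
case=> /IH E; rewrite big_cons -E -subm_shift_coeff.
rewrite -/(sqall (x :: a)) big_sqall_cons mulr_suml; apply: eq_bigr => t _.
rewrite mulr_sumr; apply: eq_bigr => c _.
by rewrite eqseq_cons; case: eqP => _ /=; rewrite ?mul1r ?mul0r.
Qed.

Lemma sqt_coeff a u B : size a = size u -> sumn u = (sumn a + B)%N ->
  \sum_(c <- sqt a B) (c == u)%:R =
  \prod_(p <- zip a u) (('C(p.1, p.2 - p.1) * (p.1 <= p.2))%N)%:R :> F2.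
Proof.
move=> su sm; rewrite big_sqall -sqall_coeff // [RHS](bigID (fun c => sumn c == (sumn a + B)%N)) /=.
rewrite [X in _ + X]big1 ?addr0 // => c ne; case: eqP => // E.
by move: ne; rewrite E sm eqxx.
Qed.
End Coefficients.

Section Monomials.
Variables k n : nat.
Local Open Scope ring_scope.

Definition mseq (u : mon k n) : seq nat := [seq expo u j | j <- enum 'I_k].

Lemma size_mseq u : size (mseq u) = k.
Proof. by rewrite size_map size_enum_ord. Qed.

Lemma sum_expo (u : mon k n) : (\sum_(j < k) expo u j)%N = n.
Proof. exact/eqP/(valP u). Qed.

Lemma sumn_mseq u : sumn (mseq u) = n.
Proof. by rewrite sumnE big_map big_enum /=; apply/eqP; exact: (valP u). Qed.

Lemma nth_mseq u (j : 'I_k) : nth 0%N (mseq u) j = expo u j.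
Proof. by rewrite (nth_map j) ?size_enum_ord ?nth_ord_enum. Qed.

Lemma mseq_inj : injective mseq.
Proof.
move=> u v E; apply/val_inj/ffunP => j; apply/val_inj.
by have := nth_mseq u j; rewrite E nth_mseq.
Qed.

Lemma mseq_surj e : size e = k -> sumn e = n -> exists u, mseq u = e.
Proof.
move=> se sm.
have bnd j : (nth 0%N e j < n.+1)%N.
  rewrite ltnS -sm; case: (ltnP j (size e)) => je; last by rewrite nth_default.
  by rewrite sumnE (big_nth 0%N) (big_rem j) ?mem_index_iota //= leq_addr.
pose a := [ffun j : 'I_k => Ordinal (bnd j)].
have ap : (\sum_(j < k) (a j : nat) == n)%N.
  apply/eqP/(etrans _ sm); rewrite sumnE (big_nth 0%N) se big_mkord.
  by apply: eq_bigr => j _; rewrite ffunE.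
exists (Sub a ap); apply: (@eq_from_nth _ 0%N); rewrite size_mseq ?se // => i ik.
by rewrite (nth_mseq _ (Ordinal ik)) /expo SubK ffunE.
Qed.

(** Defined on every list, with value zero when [e] is not an exponent vector of degree [n] in [k]
    variables. *)
Definition evec (e : seq nat) : Pdeg k n := \row_c (e == mseq (enum_val c))%:R.

Lemma evec_mseq u : evec (mseq u) = emon u.
Proof.
apply/rowP => c; rewrite !mxE eqxx /=; congr (_%:R); congr nat_of_bool.
apply/eqP/eqP => [/mseq_inj ->|->]; last by rewrite enum_rankK.
by rewrite enum_valK.
Qed.

Lemma sq_monE (a : 'I_k -> nat) B : (\sum_j a j + B = n)%N ->
  sq_mon n a = \sum_(c <- sqt [seq a j | j <- enum 'I_k] B) evec c.
Proof.
move=> aB; apply/rowP => c; rewrite summxE !mxE.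
under [RHS]eq_bigr do rewrite /evec mxE.
rewrite (@sqt_coeff _ (mseq (enum_val c))) ?size_mseq ?(size_map a) ?size_enum_ord //; last first.
  by rewrite sumn_mseq sumnE big_map big_enum.
rewrite /mseq zip_map big_map big_enum natr_prod /=.
by apply: eq_bigr => j _.
Qed.

End Monomials.

Arguments mseq {k n} u.

Lemma evec_hit k n a B : size a = k -> 0 < B -> sumn a + B = n ->
  (\sum_(c <- sqt a B) evec k n c)%R \in hit k n.
Proof.
move=> sa B0 sm; have sa' : sumn a = n - B by lia.
have [u uE] := mseq_surj sa sa'.
rewrite -uE -sq_monE; last first.
  by rewrite sum_expo; lia.
apply: memv_span; apply/allpairsPdep; exists B, u; split=> //; last by rewrite mem_enum.
by rewrite mem_iota; lia.
Qed.

Lemma hit_subv k n (U : {vspace Pdeg k n}) :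
  (forall a B, size a = k -> 0 < B -> sumn a + B = n ->
     (\sum_(c <- sqt a B) evec k n c)%R \in U) -> (hit k n <= U)%VS.
Proof.
move=> H; apply/span_subvP => _ /allpairsPdep[B [u [Bin _ ->]]].
move: Bin; rewrite mem_iota => /andP[B0 Bn].
have sm : sumn (mseq u) + B = n by rewrite sumn_mseq; lia.
rewrite (@sq_monE _ _ _ B); last first.
  by rewrite sum_expo; lia.
by apply: H; rewrite ?size_mseq.
Qed.

Definition wt (e : seq nat) (i : nat) : nat := count (alpha i) e.

Lemma weight_mseq k n (u : mon k n) i : weight u i = wt (mseq u) i.
Proof.
rewrite /weight /wt -sum1_count big_map [RHS]big_mkcond big_enum /=.
by apply: eq_bigr => j _; case: alpha.
Qed.

Lemma wt0 e : wt e 0 = count odd e.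
Proof. by apply: eq_count => x; rewrite /alpha divn1. Qed.

Lemma wtS e i : wt e i.+1 = wt (map half e) i.
Proof.
rewrite /wt count_map; apply: eq_count => x /=.
by rewrite /alpha expnS divnMA divn2.
Qed.

Lemma lexlowP w e : reflect
  (exists i, [/\ i < size w, forall j, j < i -> wt e j = nth 0 w j & wt e i < nth 0 w i])
  (lexlow w e).
Proof.
elim: w e => [|w0 w IH] e /=; first by right=> -[i []].
rewrite -wt0; case: ltngtP => [lt|gt|eq] /=.
- by left; exists 0.
- right=> -[[|i] [iw eqs lt]]; first by move: lt => /=; lia.
  by move: gt; rewrite (eqs 0) //= ltnn.
apply: (iffP (IH _)) => -[i [iw eqs lt]].
  by exists i.+1; split=> // [[|j] ji|] /=; rewrite ?wtS // eqs.
case: i iw eqs lt => [|i] iw eqs lt; first by move: lt; rewrite /= eq ltnn.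
by exists i; split=> // [j ji|]; [have := eqs j.+1 ji|move: lt]; rewrite wtS.
Qed.

Lemma wt_big e i : sumn e < 2 ^ i -> wt e i = 0.
Proof.
move=> lt; apply/eqP; rewrite -leqn0 leqNgt -has_count; apply/hasPn => x xe.
rewrite /alpha divn_small //; apply: leq_ltn_trans lt.
by rewrite sumnE (big_rem x) //= leq_addr.
Qed.

Lemma omega_dE s i : omega_d s.+2 i = nth 0 (wvec s) i.
Proof.
case: i => [//|i]; rewrite /omega_d /= nth_nseq ltnS.
by case: ltnP.
Qed.

Lemma wdegE s : wdeg s.+2 (omega_d s.+2) = wdegree s.
Proof.
rewrite /wdeg big_ord_recl /= expn0 mul1n; congr (_ + _).
have -> : (pdeg s).*2 = \sum_(i < s) 2 ^ i.+1 * 2.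
  elim: s => [|s IH]; first by rewrite big_ord0.
  rewrite big_ord_recl /= doubleD IH; congr (_ + _); rewrite -[LHS]mul2n big_distrr /=.
  by apply: eq_bigr => i _; rewrite [in RHS]expnS mulnA.
rewrite big_ord_recr /= {2}/omega_d /= ltnn muln0 addn0.
by apply: eq_bigr => i _; rewrite /omega_d /= ltnS ltn_ord.
Qed.

Lemma pushK e : push (map odd e) (map half e) = e.
Proof. by elim: e => //= x e IH; rewrite /push /= in IH *; rewrite IH odd_double_half. Qed.

Lemma bool5_pair (X : seq bool) : size X = 5 -> count id X = 2 ->
  exists2 x, x < 10 & bits x = X.
Proof.
have H : [forall X : 5.-tuple bool, (count id X == 2) ==> has (fun x => bits x == X) (iota 0 10)].
  by apply/forallP => -[X' sX']; move: sX'; case: X' => [|[] [|[] [|[] [|[] [|[] []]]]]].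
move=> sX cX; have /forallP/(_ (Tuple (introT eqP sX)))/implyP/(_ (introT eqP cX)) := H.
case/hasP=> x; rewrite mem_iota => xl /eqP xE.
by exists x.
Qed.

Lemma bool5_quad (X : seq bool) : size X = 5 -> count id X = 4 ->
  exists2 i, i < 5 & cobits i = X.
Proof.
case: X => [|a [|b [|c [|d [|e []]]]]] // _.
by case: a; case: b; case: c; case: d; case: e => // _;
   [exists 4|exists 3|exists 2|exists 1|exists 0].
Qed.

Lemma pexp_surj s e : size e = 5 -> sumn e = pdeg s ->
  (forall i, i < s -> wt e i = 2) -> exists u, [/\ letters u, size u = s & pexp u = e].
Proof.
elim: s e => [|s IH] e se sm ws.
  exists [::]; split=> //; rewrite [pexp _]/(nseq 5 0) -se.
  apply/esym/all_pred1P/allP => x xe; rewrite /= -leqn0 -[0]/(pdeg 0) -sm.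
  by rewrite sumnE (big_rem x) //= leq_addr.
have so : size (map odd e) = 5 by rewrite size_map.
have co : count id (map odd e) = 2 by rewrite -count_odd -wt0 ws.
have [x xl xE] := bool5_pair so co.
have sh : sumn (map half e) = pdeg s.
  have := sumn_push (_ : size (map odd e) = size (map half e)).
  by rewrite !size_map pushK co sm /= => /(_ erefl); lia.
have [||u [lu su uE]] := IH (map half e) _ sh; first by rewrite size_map.
  by move=> i il; rewrite -wtS ws.
by exists (x :: u); split; rewrite /= ?xl ?su // xE uE pushK.
Qed.

Lemma wt_push X e i : size X = size e ->
  wt (push X e) i = if i is j.+1 then wt e j else count id X.
Proof.
by move=> sX; case: i => [|i]; rewrite ?wt0 ?wtS ?count_odd ?odd_push ?half_push.
Qed.

Lemma wt_pexp u i : letters u -> wt (pexp u) i = nth 0 (nseq (size u) 2) i.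
Proof.
elim: u i => [|x u IH] i; first by rewrite nth_nil => _; apply: wt_big; rewrite expn_gt0.
by case/andP=> xl lu; rewrite [pexp _]/(push _ _) wt_push ?size_pexp //;
  case: i => [|i]; [exact: count_bits|exact: IH].
Qed.

Lemma wt_wexp i u j : i < 5 -> letters u -> wt (wexp i u) j = nth 0 (wvec (size u)) j.
Proof.
move=> i5 lu; rewrite wt_push ?size_pexp //.
by case: j => [|j]; [exact: count_cobits|exact: wt_pexp].
Qed.

Lemma sumn_wexp i u : i < 5 -> letters u -> sumn (wexp i u) = wdegree (size u).
Proof. by move=> i5 lu; rewrite sumn_push ?size_pexp // count_cobits // sumn_pexp. Qed.

Lemma wexp_surj s e : size e = 5 -> sumn e = wdegree s ->
  (forall i, wt e i = nth 0 (wvec s) i) ->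
  exists i u, [/\ i < 5, letters u, size u = s & wexp i u = e].
Proof.
move=> se sm we.
have so : size (map odd e) = 5 by rewrite size_map.
have co : count id (map odd e) = 4 by rewrite -count_odd -wt0 we.
have [i i5 iE] := bool5_quad so co.
have sh : sumn (map half e) = pdeg s.
  have := sumn_push (_ : size (map odd e) = size (map half e)).
  by rewrite !size_map pushK co sm /wdegree => /(_ erefl); lia.
have [||u [lu su uE]] := pexp_surj _ sh; first by rewrite size_map.
  by move=> j js; rewrite -wtS we /= nth_nseq js.
by exists i, u; split; rewrite // /wexp iE uE pushK.
Qed.

Section Weights.
Variables (s n : nat) (w : nat -> nat).
Hypothesis nE : n = wdegree s.
Hypothesis wE : forall i, w i = nth 0 (wvec s) i.

Lemma size_wvec : size (wvec s) = s.+1. Proof. by rewrite /= size_nseq. Qed.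

Lemma s_lt_n : s < n.
Proof.
rewrite nE /wdegree; suff : s <= pdeg s by lia.
by elim: s => //= m IH; lia.
Qed.

(** The first difference of a smaller weight lies among the first [s.+1] entries: beyond them [w] is
    zero, and nothing is smaller. The bound [s < n] places these entries within the range of
    [lex_lt]. *)
Lemma lex_lt_lexlow (u : mon 5 n) : lex_lt n.+1 (weight u) w = lexlow (wvec s) (mseq u).
Proof.
apply/existsP/lexlowP => [[i /andP[/forallP eqs lt]]|[i [iw eqs lt]]].
  exists i; split=> [|j ji|].
  - by rewrite ltnNge; apply/negP => le; move: lt; rewrite wE nth_default.
  - have jn : j < n.+1 by apply: ltn_trans ji _.
    by have := eqs (Ordinal jn); rewrite /= ji wE weight_mseq => /eqP.
  - by move: lt; rewrite wE weight_mseq.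
have iN : i < n.+1 by have := s_lt_n; rewrite size_wvec in iw; lia.
exists (Ordinal iN); apply/andP; split; last by rewrite /= weight_mseq wE.
by apply/forallP => j; apply/implyP => ji; rewrite weight_mseq wE eqs.
Qed.

Lemma lex_eqP (u : mon 5 n) : reflect (forall i, wt (mseq u) i = nth 0 (wvec s) i)
  (lex_eq n.+1 (weight u) w).
Proof.
apply: (iffP forallP) => [H i|H i]; last by rewrite weight_mseq wE H.
case: (ltnP i n.+1) => iN; first by have := H (Ordinal iN); rewrite /= weight_mseq wE => /eqP.
rewrite nth_default ?size_wvec; last by have := s_lt_n; lia.
apply: wt_big; rewrite sumn_mseq; apply: ltn_trans (ltn_expl i _) => //; lia.
Qed.

Lemma word_mon i u : i < 5 -> letters u -> size u = s ->
  exists2 v : mon 5 n, mseq v = wexp i u & lex_eq n.+1 (weight v) w.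
Proof.
move=> i5 lu su; have [v vE] : exists v : mon 5 n, mseq v = wexp i u.
  by apply: mseq_surj; rewrite ?size_wexp ?sumn_wexp // su.
by exists v => //; apply/lex_eqP => j; rewrite vE wt_wexp // su.
Qed.

Local Open Scope ring_scope.

Lemma rV_char2 m (x : 'rV['F_2]_m) : x + x = 0.
Proof. by apply/rowP => j; rewrite !mxE F2_char. Qed.

Lemma good_linear m (l : {linear Pdeg 5 n -> 'rV['F_2]_m}) :
  (forall v, v \in hit 5 n -> l v = 0) -> (forall v, v \in Pw_minus 5 n w -> l v = 0) ->
  good 5 (wvec s) (wdegree s) (fun e => l (evec 5 n e)).
Proof.
move=> lh lm; split=> [e se sm low|a B sa B0 sm].
  rewrite -nE in sm; have [u uE] := mseq_surj se sm.
  apply: lm; rewrite -uE evec_mseq; apply/memv_span/map_f.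
  by rewrite mem_filter mem_enum andbT lex_lt_lexlow uE.
by rewrite -linear_sum lh // evec_hit // nE.
Qed.

(** The vanishing results for functions on words are applied to the values of [1 - projv U], a
    linear map whose kernel is [U]. *)
Lemma weight_span (U : {vspace Pdeg 5 n}) : (3 < s)%N ->
  (hit 5 n <= U)%VS -> (Pw_minus 5 n w <= U)%VS ->
  (forall b, b \in basis -> evec 5 n (wexp b.1 (pad s b.2)) \in U) ->
  forall u : mon 5 n, lex_eq n.+1 (weight u) w -> emon u \in U.
Proof.
move=> s4 hU mU bU u /lex_eqP wu.
pose l : {linear Pdeg 5 n -> Pdeg 5 n} := \1%VF - projv U.
have lE v : l v = 0 <-> v \in U.
  rewrite /l /= add_lfunE opp_lfunE id_lfunE; split=> [/subr0_eq->|vU]; first exact: memv_proj.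
  by rewrite projv_id ?subrr.
have gd : good 5 (wvec s) (wdegree s) (fun e => l (evec 5 n e)).
  by apply: good_linear => v vin; apply/lE; apply: subvP vin.
have [i [t [i5 lt st tE]]] : exists i t, [/\ (i < 5)%N, letters t, size t = s & wexp i t = mseq u].
  by apply: wexp_surj; rewrite ?size_mseq ?sumn_mseq.
have b0 b : b \in basis -> l (evec 5 n (wexp b.1 (pad s b.2))) = 0 by move=> /bU/lE.
have loc := good_local (@rV_char2 _) gd.
rewrite -evec_mseq -tE; apply/lE.
case: (ltnP 4 s) => [s5|s4']; first exact: (local_large_eq0 (@rV_char2 _) s5 loc b0).
have E4 : s = 4%N by lia.
move: E4 loc b0 gd st => -> loc b0 gd st.
(* The exponents and squares of these certificates are below [2 ^ 7], as their degree is 64. *)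
have hit0 r : r \in hit64_rels -> \sum_(y <- r) l (evec 5 n (wexp y.1 y.2)) = 0.
  case/hit64_relsP=> c cin ->; have [wf dec] := hit64P cin.
  rewrite big_map -[RHS](cert_sum (@rV_char2 _) (good_goodb 7 gd) wf) !big_seq.
  by apply: eq_bigr => e /dec[_ _ ->].
exact: (local4_eq0 (@rV_char2 _) loc hit0 b0 i5 lt st).
Qed.
End Weights.

Local Open Scope ring_scope.

(** * Spike functionals *)

(** The image of the monomial [x^e] when the variables are replaced by [Ls]. *)
Definition mprod (C : comNzRingType) (Ls : seq C) (e : seq nat) : C :=
  \prod_(p <- zip Ls e) p.1 ^+ p.2.

Lemma mprod_cons (C : comNzRingType) (y : C) Ls x e :
  mprod (y :: Ls) (x :: e) = y ^+ x * mprod Ls e.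
Proof. by rewrite /mprod big_cons. Qed.

Section CharTwo.
Variable C : comNzRingType.
Hypothesis char2 : forall x : C, x + x = 0.

Lemma sqrD2 (x y : C) : (x + y) ^+ 2 = x ^+ 2 + y ^+ 2.
Proof. by rewrite sqrrD mulr2n char2 addr0. Qed.

Lemma sqr_sum2 (I : Type) (r : seq I) (F : I -> C) :
  (\sum_(i <- r) F i) ^+ 2 = \sum_(i <- r) F i ^+ 2.
Proof. by elim: r => [|i r IH]; rewrite ?big_nil ?expr0n // !big_cons sqrD2 IH. Qed.

(** The total square of [y^x] when [y] has degree one. The last binary digit of [x] is split off,
    and squaring is additive. *)
Lemma sum_subm_exp (y : C) x : \sum_(t <- subm x) y ^+ (x + t) = (y + y ^+ 2) ^+ x.
Proof.
elim/ltn_ind: x y => x IH y; have [->|x0] := posnP x; first by rewrite big_seq1.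
rewrite -[x in LHS]odd_double_half big_subm_double.
have E (b : nat) : \sum_(t <- subm x./2) y ^+ (b + (x./2 + t).*2) =
    y ^+ b * (y ^+ 2 + (y ^+ 2) ^+ 2) ^+ x./2.
  rewrite -IH; last by lia.
  by rewrite mulr_sumr; apply: eq_bigr => t _; rewrite -exprM mul2n -exprD.
have -> : (y + y ^+ 2) ^+ x = (y + y ^+ 2) ^+ odd x * (y ^+ 2 + (y ^+ 2) ^+ 2) ^+ x./2.
  by rewrite -sqrD2 -exprM mul2n -exprD odd_double_half.
rewrite (eq_bigr (fun t => y ^+ (odd x + (x./2 + t).*2))); last by move=> t _; congr (_ ^+ _); lia.
rewrite E; case: (odd x); last by rewrite addr0.
rewrite (eq_bigr (fun t => y ^+ (2 + (x./2 + t).*2))); last by move=> t _; congr (_ ^+ _); lia.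
by rewrite E -mulrDl !expr1.
Qed.

Lemma sum_sqall_mprod (Ls : seq C) a : size Ls = size a ->
  \sum_(c <- sqall a) mprod Ls c = mprod [seq y + y ^+ 2 | y <- Ls] a.
Proof.
elim: a Ls => [|x a IH] [|y Ls] //; first by rewrite big_seq1.
case=> /IH E; rewrite big_sqall_cons /= mprod_cons -E -sum_subm_exp mulr_suml.
by apply: eq_bigr => t _; rewrite mulr_sumr; apply: eq_bigr => c _; rewrite mprod_cons.
Qed.

Lemma mprod_push (Ls : seq C) X e : size X = size e ->
  mprod Ls (push X e) = mprod Ls (map nat_of_bool X) * mprod Ls e ^+ 2.
Proof.
elim: X e Ls => [|b X IH] [|x e] [|y Ls] //; rewrite ?(mulr1, expr1n) //=;
  try by move=> _; rewrite /mprod big_nil ?expr1n ?mulr1.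
case=> /IH E; rewrite [push _ _]/= -/(push X e) !mprod_cons E exprMn exprD -exprM muln2.
by rewrite mulrACA.
Qed.
End CharTwo.

(** For [k > 0] the sum is odd. An odd [t] would force [e] odd and the sum even, so [t] is even and
    [e] odd; halving both leads to [k - 1]. *)
Lemma spike_subm k e t : t \in subm e -> (e + t = 2 ^ k - 1)%N -> t = 0%N.
Proof.
elim: k e t => [|k IH] e t; first by lia.
rewrite -{1}(odd_double_half e) subm_double mem_cat expnS => /orP[/mapP[u uin ->]|].
  by move=> E; rewrite (IH _ _ uin) //; lia.
by case: ifP => // oe /mapP[u uin ->] E; exfalso; lia.
Qed.

Lemma sqall_nth a c i : c \in sqall a -> (i < size a)%N ->
  exists2 t, t \in subm (nth 0%N a i) & nth 0%N c i = (nth 0%N a i + t)%N.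
Proof.
elim: a c i => [|x a IH] c i //= /flatten_mapP[t tin /mapP[c' cin ->]].
by case: i => [|i] /= il; [exists t|apply: IH].
Qed.

Lemma size_sqall a c : c \in sqall a -> size c = size a.
Proof.
elim: a c => [|x a IH] c /=; first by rewrite inE => /eqP->.
by case/flatten_mapP=> t _ /mapP[c' /IH sc ->] /=; rewrite sc.
Qed.

(** * Spikes in polynomial rings *)

Section Multivariate.
Variable r : nat.
Notation P := {mpoly 'F_2[r]}.

Lemma mpoly_char2 (p : P) : p + p = 0.
Proof. by apply/mpolyP => m; rewrite mcoeffD F2_char mcoeff0. Qed.

Lemma F2_sqr (x : 'F_2) : x ^+ 2 = x.
Proof. by case: x => [] [|[|m]] i //; apply/val_inj. Qed.

Definition linform (v : 'I_r -> 'F_2) : P := \sum_(i < r) v i *: 'X_i.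

(** Composition with this tuple is the total square of the polynomial ring, which is a ring
    morphism. *)
Definition sqtuple : r.-tuple P := [tuple 'X_i + 'X_i ^+ 2 | i < r].

Lemma linform_sq v : linform v \mPo sqtuple = linform v + linform v ^+ 2.
Proof.
rewrite /linform (sqr_sum2 mpoly_char2) linear_sum -big_split /=.
apply: eq_bigr => i _.
by rewrite comp_mpolyZ comp_mpolyXU -tnth_nth tnth_mktuple scalerDr exprZn F2_sqr.
Qed.

Definition mnm_seq (c : seq nat) : 'X_{1..r} := [multinom nth 0%N c i | i < r].

Lemma mprodX c : size c = r -> mprod [seq ('X_i : P) | i <- enum 'I_r] c = 'X_[mnm_seq c].
Proof.
move=> sc; have {1}-> : c = [seq nth 0%N c (val i) | i <- enum 'I_r].
  by rewrite map_comp val_enum_ord -sc -/(mkseq _ _) mkseq_nth.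
rewrite /mprod zip_map big_map big_enum mpolyXE_id /=.
by apply: eq_bigr => i _; rewrite mnmE.
Qed.

Definition spike (m : 'X_{1..r}) := forall i, exists k, m i = (2 ^ k - 1)%N.

(** By [spike_subm] in each variable, a spike occurs in the total square of a monomial only if it is
    that monomial, which the degrees exclude. *)
Lemma spike_comp (p : P) d m : p \is d.-homog -> spike m -> d != mdeg m ->
  (p \mPo sqtuple)@_m = 0.
Proof.
move=> /dhomogP hp sp dm; rewrite comp_mpolyEX raddf_sum big1_seq //= => m' m'in.
rewrite mcoeffZ comp_mpolyX.
have -> : \prod_(i < r) (tnth sqtuple i) ^+ m' i =
    \sum_(c <- sqall [seq m' i | i <- enum 'I_r]) 'X_[mnm_seq c].
  transitivity (\sum_(c <- sqall [seq m' i | i <- enum 'I_r])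
      mprod [seq ('X_i : P) | i <- enum 'I_r] c); last first.
    rewrite !big_seq; apply: eq_bigr => c /size_sqall sc.
    by rewrite mprodX // sc size_map size_enum_ord.
  rewrite (sum_sqall_mprod mpoly_char2) ?size_map //.
  rewrite -map_comp /mprod zip_map big_map big_enum /=.
  by apply: eq_bigr => i _; rewrite tnth_mktuple.
rewrite raddf_sum big1_seq ?mulr0 // => c /andP[_ cin] /=.
rewrite mcoeffX; case: eqP => // E; exfalso; move/negP: dm; apply; rewrite -(hp _ m'in).
apply/eqP; congr mdeg; apply/mnmP => i.
have sm : size [seq m' i | i <- enum 'I_r] = r by rewrite size_map size_enum_ord.
have ii : (i < size [seq m' i | i <- enum 'I_r])%N by rewrite sm.
have [t] := sqall_nth cin ii.
rewrite (nth_map i) ?size_enum_ord // nth_ord_enum => tin ct.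
have [k mk] := sp i; move: mk; rewrite -E mnmE ct => ek.
by rewrite (spike_subm tin ek) addn0.
Qed.

Lemma linform_homog v : linform v \is 1.-homog.
Proof.
apply: rpred_sum => i _; apply: dhomogZ; by rewrite dhomogX /= mdeg1.
Qed.

Lemma mprod_homog (Ls : seq P) e : size Ls = size e ->
  all (fun L => L \is 1.-homog) Ls -> mprod Ls e \is (sumn e).-homog.
Proof.
elim: Ls e => [|L Ls IH] [|x e] //=; first by rewrite /mprod big_nil dhomog1.
case=> se /andP[hL hLs]; rewrite mprod_cons; apply: dhomogM; last exact: IH.
by have := dhomogMn x hL; rewrite mul1n.
Qed.

(** All exponents in [H ^ 2] are even, so a contributing monomial of [A] agrees with [eps] modulo 2
    and is divisible by [t^eps]; the bound on the degree makes it equal. The coefficients of [H] are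
    their own squares. *)
Lemma mcoeff_mulsqr (A H : P) d (eps m : 'X_{1..r}) : A \is d.-homog -> (d <= mdeg eps)%N ->
  (forall i, (eps i <= 1)%N) -> (A * H ^+ 2)@_(eps + (m + m)) = A@_eps * H@_m.
Proof.
move=> /dhomogP hA dle e1.
rewrite {1}[H]mpolyE (sqr_sum2 mpoly_char2) mulr_sumr raddf_sum.
rewrite {3}[H]mpolyE raddf_sum mulr_sumr; apply: eq_bigr => e _ /=.
rewrite exprZn F2_sqr -scalerAr !mcoeffZ mcoeffX [RHS]mulrCA; congr (_ * _).
rewrite expr2 -mpolyXD.
have [->|em] := eqVneq e m; first by rewrite mulr1 addmC mcoeffMX.
rewrite mulr0 [A]mpolyE mulr_suml raddf_sum big1_seq // => k /andP[_ kin] /=.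
rewrite -scalerAl mcoeffZ -mpolyXD mcoeffX; case: eqP => [E|]; last by rewrite mulr0.
have Ei i : (k i + (e i).*2 = eps i + (m i).*2)%N.
  by have := congr1 (fun x : 'X_{1..r} => x i) E; rewrite !mnmDE !addnn.
have le i : (eps i <= k i)%N by have := Ei i; have := e1 i; lia.
have keps : k = eps.
  apply/mnmP => i; apply/eqP; rewrite eqn_leq le andbT leqNgt; apply/negP => lt.
  have : (mdeg eps < mdeg k)%N.
    rewrite !mdegE (bigD1 i) //= [X in (_ < X)%N](bigD1 i) //=.
    by rewrite -addSn leq_add // leq_sum.
  by rewrite (hA _ kin); lia.
case/eqP: em; apply/mnmP => i; have := Ei i; rewrite keps; lia.
Qed.
End Multivariate.

Section Functional.
Local Open Scope ring_scope.
Notation P := {mpoly 'F_2[4]}.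

Definition form (col : seq bool) : P := linform (fun i : 'I_4 => (nth false col i)%:R).
Definition emnm (eps : seq bool) : 'X_{1..4} := [multinom (nth false eps i : nat) | i < 4].

Lemma mcoeffMX_lt r (p : {mpoly 'F_2[r]}) (m k : 'X_{1..r}) i :
  ((k i : nat) < m i)%N -> (p * 'X_[m])@_k = 0.
Proof.
move=> lt; rewrite [p]mpolyE mulr_suml raddf_sum big1 // => e _ /=.
rewrite -scalerAl mcoeffZ -mpolyXD mcoeffX; case: eqP => [E|]; last by rewrite mulr0.
by move: lt; rewrite -E mnmDE; lia.
Qed.

Lemma addb_F2 (a b : bool) : (a (+) b)%:R = a%:R + b%:R :> 'F_2.
Proof. by case: a b => [] []; apply/val_inj. Qed.

Lemma lcoefP cols eps : size eps = 4%N ->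
  (\prod_(col <- cols) form col)@_(emnm eps) = (lcoef cols eps)%:R.
Proof.
elim: cols eps => [|col cols IH] eps se.
  rewrite big_nil mcoeff1; congr (_%:R); congr nat_of_bool.
  case: eps se => [|a [|b [|c [|d []]]]] //= _.
  apply/eqP/idP => [E|]; last first.
    rewrite !orbF !negb_or => /and4P[/negPf-> /negPf-> /negPf-> /negPf->].
    by apply/mnmP => i; rewrite mnm0E mnmE; case: i => [] [|[|[|[|]]]].
  have Ei (i : 'I_4) : nth false [:: a; b; c; d] i = false.
    by have := congr1 (fun m : 'X_{1..4} => m i) E; rewrite mnm0E mnmE; case: nth.
  have := Ei (inord 0); have := Ei (inord 1); have := Ei (inord 2); have := Ei (inord 3).
  by rewrite !inordK //= => -> -> -> ->.
rewrite big_cons /form /linform mulr_suml raddf_sum /=.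
have T (r : 'I_4) : ((nth false col r)%:R *: 'X_r * \prod_(c <- cols) form c)@_(emnm eps) =
   [&& nth false col r, nth false eps r & lcoef cols (set_nth false eps r false)]%:R :> 'F_2.
  rewrite -scalerAl mcoeffZ; case: (nth false col r); rewrite ?mul0r // mul1r /= mulrC.
  case: (boolP (nth false eps r)) => er /=; last first.
    by apply: (@mcoeffMX_lt _ _ _ _ r); rewrite mnm1E eqxx mnmE (negPf er).
  rewrite -IH; last by rewrite size_set_nth se; case: r {er} => [] [|[|[|[|]]]].
  have -> : emnm eps = (U_(r) + emnm (set_nth false eps r false))%MM.
    apply/mnmP => i; rewrite mnmDE mnm1E !mnmE nth_set_nth /= val_eqE.
    have [->|ne] := eqVneq i r; first by rewrite er.
    by [].
  by rewrite mcoeffMX.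
rewrite (eq_bigr _ (fun r _ => T r)) 4!big_ord_recl big_ord0 addr0.
by rewrite /= !addb_F2 addr0.
Qed.

Definition eps4 := emnm [:: true; true; true; true].
Definition eps2 := emnm [:: true; true; false; false].

(** The spike is built digit by digit, in step with [push], so that [mcoeff_push] peels off one
    level at a time. *)
Fixpoint tail_mnm (s : nat) : 'X_{1..4} :=
  if s is s'.+1 then (eps2 + (tail_mnm s' + tail_mnm s'))%MM else 0%MM.
Definition top_mnm s : 'X_{1..4} := (eps4 + (tail_mnm s + tail_mnm s))%MM.

Lemma mdeg_eps4 : mdeg eps4 = 4.
Proof. by rewrite mdegE !big_ord_recl big_ord0 !mnmE. Qed.

Lemma mdeg_eps2 : mdeg eps2 = 2.
Proof. by rewrite mdegE !big_ord_recl big_ord0 !mnmE. Qed.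

Lemma mdeg_tail s : mdeg (tail_mnm s) = pdeg s.
Proof. by elim: s => [|s IH] /=; rewrite ?mdeg0 // !mdegD mdeg_eps2 IH addnn. Qed.

Lemma mdeg_top s : mdeg (top_mnm s) = wdegree s.
Proof. by rewrite /top_mnm !mdegD mdeg_eps4 mdeg_tail addnn. Qed.

Lemma emnm_le1 eps (i : 'I_4) : (emnm eps i <= 1)%N.
Proof. by rewrite mnmE; case: nth. Qed.

Lemma tail_mnmE s (i : 'I_4) : tail_mnm s i = (if (i < 2)%N then 2 ^ s - 1 else 0)%N.
Proof.
elim: s => [|s IH]; first by rewrite mnm0E; case: ifP.
rewrite /= !mnmDE IH mnmE expnS.
have := expn_gt0 2 s; case: i {IH} => [] [|[|[|[|]]]] //= _; lia.
Qed.

Lemma spike_top s : spike (top_mnm s).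
Proof.
move=> i; rewrite /top_mnm !mnmDE tail_mnmE mnmE; have := expn_gt0 2 s.
case: i => [] [|[|[|[|i]]]] //= _ _; [exists s.+1|exists s.+1|exists 1%N|exists 1%N];
  by rewrite ?expnS; lia.
Qed.

Variable vs : seq (seq bool).
Let Ls : seq P := map form (columns vs).

Lemma mprod_mask X : size X = 5%N ->
  mprod Ls (map nat_of_bool X) = \prod_(col <- mask X (columns vs)) form col.
Proof.
rewrite -[5%N]/(size (columns vs)) /Ls.
elim: X (columns vs) => [|b X IH] [|col cols] //; first by rewrite /mprod !big_nil.
case=> /IH E; rewrite mprod_cons E; case: b => /=; last by rewrite expr0 mul1r.
by rewrite big_cons expr1.
Qed.

Lemma forms_homog : all (fun L => L \is 1.-homog) Ls.
Proof. by apply/allP=> L /mapP[col _ ->]; apply: linform_homog. Qed.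

Lemma mask_homog X : size X = 5%N -> mprod Ls (map nat_of_bool X) \is (count id X).-homog.
Proof.
move=> sX; have -> : count id X = sumn (map nat_of_bool X) by rewrite sumn_count.
by apply: mprod_homog; rewrite ?forms_homog // size_map sX.
Qed.

Lemma mcoeff_push X e eps m : size X = 5%N -> size e = 5%N ->
  (count id X <= mdeg (emnm eps))%N ->
  (mprod Ls (push X e))@_(emnm eps + (m + m)) =
  (mprod Ls (map nat_of_bool X))@_(emnm eps) * (mprod Ls e)@_m.
Proof.
move=> sX se cX; rewrite mprod_push ?sX //.
by apply: mcoeff_mulsqr (mask_homog sX) cX _ => i; apply: emnm_le1.
Qed.

(** At the first level where the weight drops, fewer than two linear forms are multiplied, and their
    product has too small a degree to contain [t_1 t_2]. *)
Lemma tail_lexlow s e : size e = 5%N -> lexlow (nseq s 2) e -> (mprod Ls e)@_(tail_mnm s) = 0.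
Proof.
elim: s e => [//|s IH] e se low.
have so : size (map odd e) = 5%N by rewrite size_map.
have sh : size (map half e) = 5%N by rewrite size_map.
move: low; rewrite -(pushK e) [lexlow _ _]/= count_odd odd_push ?half_push ?so ?sh //.
rewrite [tail_mnm _]/= => /orP[lt|/andP[/eqP c2 low]].
  rewrite mcoeff_push ?mdeg_eps2 1?ltnW //.
  by rewrite (dhomog_nemf_coeff (mask_homog so)) ?mul0r //= mdeg_eps2; lia.
by rewrite mcoeff_push ?mdeg_eps2 ?c2 // IH // mulr0.
Qed.

Lemma top_lexlow s e : size e = 5%N -> lexlow (wvec s) e -> (mprod Ls e)@_(top_mnm s) = 0.
Proof.
move=> se low.
have so : size (map odd e) = 5%N by rewrite size_map.
have sh : size (map half e) = 5%N by rewrite size_map.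
move: low; rewrite -(pushK e) [lexlow _ _]/= count_odd odd_push ?half_push ?so ?sh //.
case/orP=> [lt|/andP[/eqP c2 low]].
  rewrite mcoeff_push ?mdeg_eps4 1?ltnW //.
  by rewrite (dhomog_nemf_coeff (mask_homog so)) ?mul0r //= mdeg_eps4; lia.
by rewrite mcoeff_push ?mdeg_eps4 ?c2 // tail_lexlow // mulr0.
Qed.

Lemma tail_word u : letters u ->
  (mprod Ls (pexp u))@_(tail_mnm (size u)) = (all (plane_coef vs) u)%:R.
Proof.
elim: u => [|x u IH].
  move=> _; suff -> : mprod Ls (pexp [::]) = 1 by rewrite mcoeff1 eqxx.
  rewrite [pexp _]/(nseq 5 0%N); elim: 5%N Ls => [|k IH] [|y L]; try by rewrite /mprod /= big_nil.
  by rewrite mprod_cons IH mulr1.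
case/andP=> xl /IH E; rewrite [pexp _]/(push _ _) [tail_mnm _]/=.
rewrite mcoeff_push ?size_pexp //; last first.
  by rewrite mdeg_eps2 count_bits.
rewrite E mprod_mask // lcoefP //= -/(plane_coef vs x).
by case: plane_coef; case: all; rewrite ?mulr0 ?mul0r ?mulr1.
Qed.

Lemma top_word i u : (i < 5)%N -> letters u ->
  (mprod Ls (wexp i u))@_(top_mnm (size u)) = (word_coef vs i u)%:R.
Proof.
move=> i5 lu; rewrite /wexp mcoeff_push ?size_pexp //; last by rewrite mdeg_eps4 count_cobits.
rewrite tail_word // mprod_mask // lcoefP // -/(top_coef vs i) /word_coef.
by case: top_coef; case: all; rewrite ?mulr0 ?mul0r ?mulr1.
Qed.

(** Substituting linear forms commutes with the total square by [linform_sq], and the spike has a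
    degree different from that of the substituted [x^a]; [spike_comp] concludes. *)
Lemma top_hit s a B : size a = 5%N -> (0 < B)%N -> (sumn a + B)%N = wdegree s ->
  \sum_(c <- sqt a B) (mprod Ls c)@_(top_mnm s) = 0.
Proof.
move=> sa B0 sm; have sL : size Ls = size a by rewrite sa.
(* Terms of other degrees do not meet the spike, so [Sq^B] may be replaced by the total square. *)
rewrite big_sqall; transitivity (\sum_(c <- sqall a) (mprod Ls c)@_(top_mnm s)).
  rewrite [RHS](bigID (fun c => sumn c == sumn a + B)%N) /= [X in _ = _ + X]big1_seq ?addr0 //.
  move=> c /andP[ne /size_sqall sc].
  have sLc : size Ls = size c by rewrite sL sc.
  by rewrite (dhomog_nemf_coeff (mprod_homog sLc forms_homog)) //= mdeg_top -sm eq_sym.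
rewrite -raddf_sum (sum_sqall_mprod (@mpoly_char2 _)) //.
have -> : mprod [seq y + y ^+ 2 | y <- Ls] a = mprod Ls a \mPo sqtuple 4.
  rewrite /mprod rmorph_prod /Ls.
  elim: (columns vs) a {sa sm sL} => [|col cols IH] [|x a]; try by rewrite /= !big_nil.
  by rewrite /= !big_cons IH rmorphXn /= linform_sq.
apply: (spike_comp (mprod_homog sL forms_homog) (@spike_top s)).
by rewrite mdeg_top; lia.
Qed.
End Functional.

(** * Dimensions and admissible monomials *)

Section Chain.
Variables (K : fieldType) (vT : vectType K).

(** Turns the count of admissible monomials into a dimension: a monomial is admissible when it
    enlarges the span of the smaller ones. *)
Lemma chain_dim (x0 : vT) (R : {vspace vT}) (l : seq vT) :
  \dim (R + <<l>>) =
  (\dim R + \sum_(i < size l) (nth x0 l i \notin R + <<take i l>>)%VS)%N.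
Proof.
elim/last_ind: l => [|l x IH]; first by rewrite big_ord0 span_nil addv0 addn0.
rewrite size_rcons big_ord_recr /= nth_rcons ltnn eqxx.
rewrite -cats1 take_size_cat // span_cat span_seq1 addvA addnA.
have -> : (\sum_(i < size l) (nth x0 (l ++ [:: x]) i \notin R + <<take i (l ++ [:: x])>>)%VS)%N =
          (\sum_(i < size l) (nth x0 l i \notin R + <<take i l>>)%VS)%N.
  by apply: eq_bigr => i _; rewrite nth_cat ltn_ord takel_cat // ltnW.
rewrite -IH; case: (boolP (x \in R + <<l>>)%VS) => xin /=.
  by rewrite addn0; congr (\dim _); apply/addv_idPl; rewrite -memvE.
rewrite dimv_disjoint_sum ?dim_vline; last first.
  apply/eqP; rewrite -subv0; apply/subvP => v; rewrite memv_cap => /andP[vin /vlineP[k vk]].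
  have [k0|k0] := eqVneq k 0; first by rewrite vk k0 scale0r mem0v.
  case/negP: xin; have -> : x = k^-1 *: v by rewrite vk scalerK.
  exact: memvZ.
suff -> : x != 0 by [].
by apply: contraNneq xin => ->; rewrite mem0v.
Qed.

Lemma free_filter (I : eqType) (f : I -> vT) (r : seq I) (Q : pred I) :
  free (map f r) -> free [seq f i | i <- r & Q i].
Proof.
move=> fr; have : free (map f (filter Q r ++ filter (predC Q) r)).
  by rewrite -(perm_free (perm_map f (permEl (perm_filterC Q r)))) in fr.
by rewrite map_cat => /catl_free.
Qed.
End Chain.

Section Sigma.
Variables k n : nat.
Implicit Types u v : mon k n.

Lemma sigma_ltP u v : reflect
  (exists j : 'I_k, (forall l : 'I_k, (l < j)%N -> expo u l = expo v l) /\ (expo u j < expo v j)%N)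
  (sigma_lt u v).
Proof.
apply: (iffP existsP) => -[j]; last by case=> eqs lt; exists j; rewrite lt andbT;
  apply/forallP => l; apply/implyP => /eqs->.
case/andP=> /forallP eqs lt; exists j; split=> // l lj.
by apply/eqP; move: (eqs l); rewrite lj.
Qed.

Lemma sigma_lt_irr u : ~~ sigma_lt u u.
Proof. by apply/sigma_ltP => -[j [_]]; rewrite ltnn. Qed.

Lemma sigma_lt_trans : transitive (@sigma_lt k n).
Proof.
move=> v u t /sigma_ltP[i [ei li]] /sigma_ltP[j [ej lj]]; apply/sigma_ltP.
case: (ltngtP i j) => ij.
- exists i; split; last by rewrite -ej.
  by move=> l lt; rewrite ei // ej // (ltn_trans lt).
- exists j; split; last by rewrite ei.
  by move=> l lt; rewrite ei ?ej // (ltn_trans lt).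
- move/val_inj: ij => ij; rewrite ij in ei li; exists j; split; last exact: ltn_trans li lj.
  by move=> l lt; rewrite ei // ej.
Qed.

Lemma sigma_lt_total u v : u != v -> sigma_lt u v || sigma_lt v u.
Proof.
move=> uv; have [j0 j0P] : exists j, expo u j != expo v j.
  apply/existsP; apply: contraNT uv; rewrite negb_exists => /forallP eqs.
  apply/eqP/val_inj/ffunP => j; apply/val_inj.
  by move: (eqs j); rewrite negbK => /eqP.
case: (@arg_minnP _ j0 (fun j => expo u j != expo v j) (@nat_of_ord k) j0P) => j jP jmin.
have eqs (l : 'I_k) : (l < j)%N -> expo u l = expo v l.
  by move=> lj; apply/eqP; apply: contraLR lj => /jmin; rewrite -leqNgt.
case: (ltngtP (expo u j) (expo v j)) jP => // lt _; apply/orP; [left|right];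
  by apply/sigma_ltP; exists j; split=> // l /eqs.
Qed.
End Sigma.

(** * Projection onto the positive monomials *)

Section Positive.
Variables k n : nat.

Definition pos_mx : 'M['F_2]_#|mon k n| := diag_mx (\row_c (posmon (enum_val c))%:R).
Definition pos_proj : 'End(Pdeg k n) := linfun (mulmxr pos_mx).

Lemma pos_proj_emon u : pos_proj (emon u) = (posmon u)%:R *: emon u.
Proof. by rewrite lfunE /= -rowE row_diag_mx mxE enum_rankK. Qed.

(** A nonzero coefficient forces both monomials to involve the same variables: [C(0, b)] is zero for
    [b > 0], and an exponent never decreases. *)
Lemma pos_proj_sq i (a : mon k i) :
  pos_proj (sq_mon n (expo a)) = (posmon a)%:R *: sq_mon n (expo a).
Proof.
rewrite lfunE /=; apply/rowP => c; rewrite mul_mx_diag !mxE mulrC.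
set C := (\prod_(j < k) _)%N.
have [->//|ne] := eqVneq (posmon a) (posmon (enum_val c)).
suff -> : C = 0%N by rewrite !mulr0.
have [j aj] : exists j, (expo a j == 0)%N != (expo (enum_val c) j == 0)%N.
  apply/existsP; apply: contraNT ne; rewrite negb_exists => /forallP eqs.
  by apply/eqP; apply: eq_forallb => j; rewrite !lt0n; move: (eqs j); rewrite negbK => /eqP->.
apply/eqP; rewrite /C (bigD1 j) //= muln_eq0; apply/orP; left.
case: (posnP (expo a j)) aj => [->|a0]; case: (posnP (expo (enum_val c) j)) => [->|c0] //.
- by rewrite bin0n subn0 (gtn_eqF c0).
- by rewrite leqNgt a0 muln0.
Qed.

Lemma pos_proj_hit v : v \in hit k n -> pos_proj v \in hit k n.
Proof.
suff : (pos_proj @: hit k n <= hit k n)%VS by move/subvP => H vin; apply/H/memv_img.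
rewrite limg_span; apply/span_subvP => _ /mapP[_ /allpairsPdep[i [a [iin ain ->]]] ->].
rewrite pos_proj_sq; apply/memvZ/memv_span; apply/allpairsPdep.
by exists i, a.
Qed.
End Positive.

Lemma in_letter_nth x j : (j < 5)%N -> nth false (bits x) j = in_letter x j.
Proof. by move=> j5; rewrite (nth_map 0%N) ?size_iota // nth_iota. Qed.

Lemma nth_push X e j : size X = size e -> (j < size e)%N ->
  nth 0%N (push X e) j = (nth false X j + (nth 0%N e j).*2)%N.
Proof.
elim: X e j => [|b X IH] [|x e] [|j] //= [] sX je; exact: IH.
Qed.

Lemma nth_pexp_gt0 u j : (j < 5)%N -> (0 < nth 0%N (pexp u) j)%N = has (in_letter^~ j) u.
Proof.
move=> j5; elim: u => [|x u IH].
  by case: j j5 => [|[|[|[|[|j]]]]].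
rewrite [pexp _]/(push _ _) nth_push ?size_pexp // in_letter_nth //= -IH.
by case: (in_letter x j) => //=; rewrite double_gt0.
Qed.

Lemma wexp_positive i u : (i < 5)%N ->
  all (ltn 0) (wexp i u) = has (in_letter^~ i) u.
Proof.
move=> i5; rewrite -nth_pexp_gt0 //.
have E j : (j < 5)%N -> nth 0%N (wexp i u) j = ((j != i) + (nth 0%N (pexp u) j).*2)%N.
  by move=> j5; rewrite nth_push ?size_pexp // (nth_map 0%N) ?size_iota // nth_iota.
apply/(all_nthP 0%N)/idP => [/(_ i)|pos j].
  by rewrite size_wexp i5 E // eqxx /= add0n double_gt0 => /(_ isT).
rewrite size_wexp => j5; rewrite /= E //; have [->|ne] //= := eqVneq j i.
by rewrite add0n double_gt0.
Qed.

Lemma posmon_mseq k n (u : mon k n) : posmon u = all (ltn 0%N) (mseq u).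
Proof.
rewrite all_map; apply/forallP/allP => [H j _|H j]; first exact: H.
by apply: H; rewrite mem_enum.
Qed.

(** * Basis modulo hit elements and lower weights *)

Section Main.
Variables (s n : nat) (w : nat -> nat).
Hypothesis s4 : (3 < s)%N.
Hypothesis nE : n = wdegree s.
Hypothesis wE : forall i, w i = nth 0%N (wvec s) i.

Let H := hit 5 n.
Let Pm := Pw_minus 5 n w.
Let R := (H + Pm)%VS.

Definition bexp (b : nat * seq nat) : seq nat := wexp b.1 (pad s b.2).

Lemma basis_wf b : b \in basis -> [/\ (b.1 < 5)%N, letters (pad s b.2), size (pad s b.2) = s,
  letters b.2 & b.2 != [::]].
Proof.
move=> bin; have /and3P[b5 lb /andP[sb0 sb5]] := allP basis_checked b bin.
have b0 : b.2 != [::] by rewrite -size_eq0 -lt0n.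
by split=> //; [exact: letters_pad|rewrite size_pad //; apply: leq_trans s4; rewrite -ltnS].
Qed.

Lemma basis_mon b : b \in basis ->
  exists v : mon 5 n, [/\ mseq v = bexp b, lex_eq n.+1 (weight v) w & posmon v = positive_word b].
Proof.
move=> /basis_wf[b5 lp sp lb b0]; have [v vE lv] := word_mon nE wE b5 lp sp.
exists v; split=> //; rewrite posmon_mseq vE wexp_positive //.
by apply: eq_has_r => x; rewrite mem_pad.
Qed.

Section OneFunctional.
Variable vs : seq (seq bool).
Definition functional_mx : 'M['F_2]_(#|mon 5 n|, 1) :=
  \matrix_(c, _) (mprod (map form (columns vs)) (mseq (enum_val c)))@_(top_mnm s).

Lemma functional_evec e : size e = 5%N -> sumn e = n ->
  (evec 5 n e *m functional_mx) 0 0 = (mprod (map form (columns vs)) e)@_(top_mnm s).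
Proof.
move=> se sm; have [u <-] := mseq_surj se sm.
by rewrite evec_mseq /emon -rowE !mxE enum_rankK.
Qed.

Lemma functional_kills v : v \in R -> v *m functional_mx = 0.
Proof.
suff : (R <= lker (linfun (mulmxr functional_mx)))%VS.
  by move/subvP => sub /sub; rewrite memv_ker lfunE /= => /eqP.
rewrite subv_add; apply/andP; split.
  apply: hit_subv => a B sa B0 sm; rewrite memv_ker lfunE /= mulmx_suml.
  apply/eqP/rowP => j; rewrite ord1 summxE !mxE big_seq.
  rewrite -[RHS](top_hit vs sa B0 (etrans sm nE)) [RHS]big_seq.
  by apply: eq_bigr => c /sqt_spec[sc smc]; rewrite functional_evec ?sc // smc.
apply/span_subvP => _ /mapP[u + ->]; rewrite mem_filter => /andP[low _].
rewrite memv_ker lfunE /= -evec_mseq; apply/eqP/rowP => j; rewrite ord1.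
rewrite functional_evec ?size_mseq ?sumn_mseq // top_lexlow ?mxE ?size_mseq //.
by rewrite -(lex_lt_lexlow nE wE).
Qed.

(** Padding repeats letters, which leaves the set of factors in a product of zeros and ones
    unchanged. *)
Lemma functional_basis b : b \in basis ->
  (evec 5 n (bexp b) *m functional_mx) 0 0 = (word_coef vs b.1 b.2)%:R.
Proof.
move=> /basis_wf[b5 lp sp lb b0].
rewrite functional_evec ?size_wexp ?sumn_wexp ?sp // /bexp.
have := top_word vs b5 lp; rewrite sp => ->; congr ((_ && _)%:R).
by apply: eq_all_r => x; rewrite mem_pad.
Qed.
End OneFunctional.

Lemma table_coef vs b : b \in basis ->
  nth false [seq top_coef vs i | i <- iota 0 5] b.1 &&
    all (nth false [seq plane_coef vs x | x <- iota 0 10]) b.2 = word_coef vs b.1 b.2.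
Proof.
move=> /basis_wf[b5 _ _ lb _].
rewrite (nth_map 0%N) ?size_iota // nth_iota // add0n; congr (_ && _).
apply: eq_in_all => x /(allP lb) x10.
by rewrite (nth_map 0%N) ?size_iota // nth_iota.
Qed.

(** Each functional kills [R], so it gives a linear equation on [c], namely a row of [lower_rows].
    By [lower_spanned] these equations imply that each [c j] is zero. *)
Lemma basis_indep (c : nat -> 'F_2) :
  \sum_(j <- iota 0 465) c j *: evec 5 n (bexp (nth (0%N, [::]) basis j)) \in R ->
  forall j, (j < 465)%N -> c j = 0.
Proof.
move=> cR j j465.
(* Column [j] is coded by the positive number [j + 1]; the predecessor undoes the shift. *)
pose f p := c (Pos.to_nat p).-1.
have fE i : f (Pos.of_succ_nat i) = c i by rewrite /f SuccNat2Pos.id_succ.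
suff : \sum_(p <- [:: Pos.of_succ_nat j]) f p = 0 by rewrite big_seq1 fE.
apply: (spannedP F2_char lower_spanned); last first.
  by rewrite /lower_targets map_f // mem_iota.
move=> _ /mapP[vs _ ->].
rewrite big_map big_filter.
have basisE : basis = [seq nth (0%N, [::]) basis i | i <- iota 0 465].
  by rewrite -size_basis -/(mkseq _ _) mkseq_nth.
have -> : zip (iota 0 465) basis = [seq (i, nth (0%N, [::]) basis i) | i <- iota 0 465].
  by rewrite {1}basisE -{1}[iota 0 465]map_id zip_map.
pose B i := nth (0%N, [::]) basis i.
have Bin i : i \in iota 0 465 -> B i \in basis.
  by rewrite mem_iota => /andP[_ i465]; rewrite mem_nth // size_basis.
transitivity (\sum_(i <- iota 0 465 | word_coef vs (B i).1 (B i).2) c i).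
  rewrite big_map big_seq_cond [RHS]big_seq_cond; apply: eq_big => [i|i _]; last exact: fE.
  by apply: andb_id2l => /Bin; apply: table_coef.
have := functional_kills vs cR; move/rowP/(_ 0); rewrite mulmx_suml summxE mxE => E.
rewrite -[RHS]E big_mkcond !big_seq; apply: eq_bigr => i /Bin bin.
rewrite -scalemxAl mxE (functional_basis vs bin).
by case: word_coef; rewrite ?mulr1 ?mulr0.
Qed.

Definition bvec b : Pdeg 5 n := evec 5 n (bexp b).

Lemma basis_free : free (map bvec basis).
Proof.
have sz : size (map bvec basis) = 465%N by rewrite size_map size_basis.
rewrite -[map _ _]/(tval (in_tuple (map bvec basis))); apply/freeP => k k0 i.
pose c j := if insub j is Some i' then k i' else 0.
have cE (i' : 'I_(size (map bvec basis))) : c i' = k i' by rewrite /c valK.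
rewrite -cE; apply: basis_indep; last by rewrite -sz.
suff -> : \sum_(j <- iota 0 465) c j *: evec 5 n (bexp (nth (0%N, [::]) basis j)) = 0.
  exact: mem0v.
rewrite -sz -[size _]subn0 -/(index_iota 0 _) big_mkord -[RHS]k0.
apply: eq_bigr => i' _; rewrite cE; congr (_ *: _).
by rewrite (nth_map (0%N, [::])) // -(size_map bvec).
Qed.

Lemma basis_disjoint : (<<map bvec basis>> :&: R = 0)%VS.
Proof.
apply/eqP; rewrite -subv0; apply/subvP => v; rewrite memv_cap => /andP[vB vR].
rewrite memv0; have vE := coord_span (X := in_tuple (map bvec basis)) vB.
have sz : size (map bvec basis) = 465%N by rewrite size_map size_basis.
pose c j := if insub j is Some i' then coord (in_tuple (map bvec basis)) i' v else 0.
have cE (i' : 'I_(size (map bvec basis))) : c i' = coord (in_tuple (map bvec basis)) i' v.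
  by rewrite /c valK.
have vE' : v = \sum_(j <- iota 0 465) c j *: evec 5 n (bexp (nth (0%N, [::]) basis j)).
  rewrite {1}vE -sz -[size _ in RHS]subn0 -/(index_iota 0 _) big_mkord.
  apply: eq_bigr => i' _; rewrite cE; congr (_ *: _).
  by rewrite (nth_map (0%N, [::])) // -(size_map bvec).
have c0 := basis_indep (c := c); rewrite -vE' in c0.
rewrite vE' big_seq big1 // => j; rewrite mem_iota => /andP[_ j465].
by rewrite c0 ?scale0r.
Qed.

(** The basis is free and its span meets [R] trivially, hence also any subspace of [R]. *)
Lemma dim_sub_basis (Q : pred (nat * seq nat)) (S : {vspace Pdeg 5 n}) : (S <= R)%VS ->
  \dim (<<[seq bvec b | b <- basis & Q b]>> + S) = (count Q basis + \dim S)%N.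
Proof.
move=> SR; have fr := free_filter Q basis_free.
rewrite dimv_disjoint_sum.
  by move: fr; rewrite /free => /eqP->; rewrite size_map size_filter.
apply/eqP; rewrite -subv0 -basis_disjoint; apply: capvS => //.
by apply: sub_span => v /mapP[b]; rewrite mem_filter => /andP[_ bin] ->; apply: map_f.
Qed.

Lemma weight_basis_span (u : mon 5 n) : lex_eq n.+1 (weight u) w ->
  emon u \in (R + <<map bvec basis>>)%VS.
Proof.
apply: (weight_span nE wE s4).
- by rewrite -[X in (X <= _)%VS]addv0 addvS ?sub0v // addvSl.
- exact: subv_trans (addvSr _ _) (addvSl _ _).
- move=> b bin; by apply: (subvP (addvSr R _)); apply: memv_span; apply: (map_f bvec).
Qed.

Definition Bpos := [seq bvec b | b <- basis & positive_word b].

Lemma pos_proj_R v : v \in R -> pos_proj 5 n v \in R.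
Proof.
case/memv_addP => h hH [p pP ->]; rewrite linearD memv_add ?pos_proj_hit //.
suff : (pos_proj 5 n @: Pm <= Pm)%VS by move/subvP; apply; apply: memv_img.
rewrite limg_span; apply/span_subvP => _ /mapP[_ /mapP[u uin ->] ->].
by rewrite pos_proj_emon; apply/memvZ/memv_span/map_f.
Qed.

Lemma pos_proj_basis v : v \in <<map bvec basis>>%VS -> pos_proj 5 n v \in <<Bpos>>%VS.
Proof.
suff : (pos_proj 5 n @: <<map bvec basis>> <= <<Bpos>>)%VS by move/subvP => S /(memv_img _)/S.
rewrite limg_span; apply/span_subvP => _ /mapP[_ /mapP[b bin ->] ->].
have [u [uE _ up]] := basis_mon bin.
rewrite /bvec -uE evec_mseq pos_proj_emon up.
case pb: (positive_word b); last by rewrite scale0r mem0v.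
apply: memvZ; apply: memv_span; rewrite -evec_mseq uE.
by apply: (map_f bvec); rewrite mem_filter pb.
Qed.

Lemma positive_basis_span (u : mon 5 n) : lex_eq n.+1 (weight u) w -> posmon u ->
  emon u \in (R + <<Bpos>>)%VS.
Proof.
move=> uw up; have := weight_basis_span uw => /memv_addP[r rR [b bB E]].
have -> : emon u = pos_proj 5 n (emon u) by rewrite pos_proj_emon up scale1r.
by rewrite E linearD memv_add ?pos_proj_R ?pos_proj_basis.
Qed.

Let QP := QPrel 5 n w.

Lemma QPrel_subR : (QP <= R)%VS.
Proof. by rewrite addvS // capvSl. Qed.

(** The modular law: since [v], the lower-weight part and the part in [T] all lie in [Pw], so does
    the hit part. This passes from all hit elements to those inside [Pw]. *)
Lemma QPrel_modular (T : {vspace Pdeg 5 n}) v : (T <= Pw 5 n w)%VS ->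
  v \in Pw 5 n w -> v \in (R + T)%VS -> v \in (T + QP)%VS.
Proof.
move=> TP vP /memv_addP[_ /memv_addP[h hH [p pP ->]] [t tT E]].
have PP : (Pm <= Pw 5 n w)%VS.
  apply: sub_span => x /mapP[u]; rewrite mem_filter => /andP[lt uin] ->.
  by apply: map_f; rewrite mem_filter lt.
have hP : h \in Pw 5 n w.
  have -> : h = v - p - t by rewrite E; rewrite addrAC addrK addrK.
  exact: memvB (memvB vP (subvP PP _ pP)) (subvP TP _ tT).
by rewrite E addrC memv_add // memv_add // memv_cap hH.
Qed.

Lemma basis_sub_Pw : (<<map bvec basis>> <= Pw 5 n w)%VS.
Proof.
apply: sub_span => _ /mapP[b bin ->]; have [u [uE uw _]] := basis_mon bin.
rewrite /bvec -uE evec_mseq; apply: map_f.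
by rewrite mem_filter uw orbT mem_enum.
Qed.

Lemma dimQP_main : dimQP 5 n w = 465%N.
Proof.
rewrite /dimQP; have -> : Pw 5 n w = (<<[seq bvec b | b <- basis & predT b]>> + QP)%VS.
  rewrite filter_predT; apply/eqP; rewrite eqEsubv subv_add basis_sub_Pw /=; apply/andP; split.
    apply/span_subvP => _ /mapP[u + ->]; rewrite mem_filter => /andP[ltq uin].
    apply: QPrel_modular; first exact: basis_sub_Pw.
      by apply: memv_span; apply: map_f; rewrite mem_filter ltq.
    case/orP: ltq => [lt|eq]; last exact: weight_basis_span.
    apply: (subvP (addvSl _ _)); apply: (subvP (addvSr _ _)); apply: memv_span; apply: map_f.
    by rewrite mem_filter lt.
  rewrite subv_add capvSr /=; apply: sub_span => x /mapP[u]; rewrite mem_filter => /andP[lt uin] ->.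
  by apply: map_f; rewrite mem_filter lt.
by rewrite dim_sub_basis ?QPrel_subR // count_predT size_basis addnK.
Qed.

Lemma Bpos_sub_Pw : (<<Bpos>> <= Pw_plus 5 n w)%VS.
Proof.
apply: sub_span => _ /mapP[b + ->]; rewrite mem_filter => /andP[pb bin].
have [u [uE uw up]] := basis_mon bin.
rewrite /bvec -uE evec_mseq; apply: map_f.
by rewrite mem_filter uw orbT mem_enum up pb.
Qed.

Lemma dimQPplus_main : dimQPplus 5 n w = 290%N.
Proof.
have PP : (Pw_plus 5 n w <= Pw 5 n w)%VS.
  apply: sub_span => x /mapP[u]; rewrite mem_filter => /andP[/andP[_ lt] uin] ->.
  by apply: map_f; rewrite mem_filter lt.
rewrite /dimQPplus; have -> : (Pw_plus 5 n w + QPrel 5 n w = <<Bpos>> + QP)%VS.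
  apply/eqP; rewrite eqEsubv subv_add addvSr andbT; apply/andP; split; last first.
    by rewrite addvS // Bpos_sub_Pw.
  apply/span_subvP => _ /mapP[u + ->]; rewrite mem_filter => /andP[/andP[up ltq] uin].
  apply: QPrel_modular; first exact: subv_trans Bpos_sub_Pw PP.
    by apply: memv_span; apply: map_f; rewrite mem_filter ltq.
  case/orP: ltq => [lt|eq]; last exact: positive_basis_span.
  apply: (subvP (addvSl _ _)); apply: (subvP (addvSr _ _)); apply: memv_span; apply: map_f.
  by rewrite mem_filter lt.
by rewrite dim_sub_basis ?QPrel_subR // count_positive_basis addnK.
Qed.

Let T (u : mon 5 n) := lex_eq n.+1 (weight u) w && posmon u.

(** [pos_proj] fixes [emon u], preserves [R] and removes the smaller monomials that are not
    positive. Those of lower weight lie in [R], and at equal weight only [sigma_lt] is left. *)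
Lemma admissible_positive u : T u -> admissible u =
  (emon u \notin (R + <<[seq emon v | v <- enum (mon 5 n) & T v && sigma_lt v u]>>)%VS).
Proof.
case/andP=> uw up; have we i : (i < n.+1)%N -> weight u i = w i.
  by move=> i1; rewrite weight_mseq wE; apply: (lex_eqP nE wE).
have ltE v : lex_lt n.+1 (weight v) (weight u) = lex_lt n.+1 (weight v) w.
  apply: eq_existsb => i; rewrite we //; congr (_ && _).
  by apply: eq_forallb => j; rewrite we.
have eqE v : lex_eq n.+1 (weight v) (weight u) = lex_eq n.+1 (weight v) w.
  by apply: eq_forallb => j; rewrite we.
rewrite /admissible; congr negb; apply/idP/idP => uin.
  have -> : emon u = pos_proj 5 n (emon u) by rewrite pos_proj_emon up scale1r.
  case/memv_addP: uin => h hH [b bB ->]; rewrite linearD; apply: memvD.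
    by apply: (subvP (addvSl _ _)); apply: (subvP (addvSl _ _)); apply: pos_proj_hit.
  set X := (_ + _)%VS; set S := [seq _ | _ <- _ & _] in bB.
  suff : (pos_proj 5 n @: <<S>> <= X)%VS by move/subvP; apply; apply: memv_img.
  rewrite limg_span; apply/span_subvP => _ /mapP[_ /mapP[v + ->] ->].
  rewrite mem_filter /mon_lt ltE eqE pos_proj_emon => /andP[vu vin].
  case pv: (posmon v); last by rewrite scale0r mem0v.
  apply: memvZ; case/orP: vu => [lt|/andP[eq sg]].
    apply: (subvP (addvSl _ _)); apply: (subvP (addvSr _ _)); apply: memv_span.
    by apply: map_f; rewrite mem_filter lt.
  apply: (subvP (addvSr _ _)); apply: memv_span; apply: map_f.
  by rewrite mem_filter vin sg /T eq pv.
rewrite -addvA in uin; apply: subvP uin; rewrite addvS //.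
rewrite subv_add; apply/andP; split; apply: sub_span => _ /mapP[v + ->];
  rewrite mem_filter => /andP[lt vin]; apply: map_f; rewrite mem_filter vin andbT /mon_lt ltE eqE ?lt //.
by case/andP: lt => /andP[-> _] ->; rewrite orbT.
Qed.

(** With the positive monomials of weight [w] sorted by [sigma_lt], [chain_dim] counts the
    admissible ones as the growth in dimension from [R] to [R + <<Bpos>>]. *)
Lemma admissible_count :
  #|[set u : mon 5 n | [&& lex_eq n.+1 (weight u) w, posmon u & admissible u]]| = 290%N.
Proof.
pose leS (u v : mon 5 n) := ~~ sigma_lt v u.
have leS_total : total leS.
  move=> u v; rewrite /leS; case: (boolP (sigma_lt v u)) => //= vu.
  by apply/negP => /(sigma_lt_trans vu); apply/negP/sigma_lt_irr.
have leS_trans : transitive leS.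
  move=> v u t uv vt; apply/negP => tu.
  have [E|ne] := eqVneq u v; first by rewrite /leS -E tu in vt.
  case/orP: (sigma_lt_total ne) => [uv'|vu]; last by rewrite /leS vu in uv.
  by rewrite /leS (sigma_lt_trans tu uv') in vt.
pose l := sort leS [seq u <- enum (mon 5 n) | T u].
have lT u : (u \in l) = T u by rewrite mem_sort mem_filter mem_enum andbT.
have lU : uniq l by rewrite sort_uniq filter_uniq // enum_uniq.
have lS : sorted leS l by apply: sort_sorted.
have spanE : (R + <<map (@emon 5 n) l>> = <<Bpos>> + R)%VS.
  have sub A B : (A <= R + B)%VS -> (R + A <= R + B)%VS.
    by move=> AB; rewrite subv_add addvSl.
  rewrite [RHS]addvC; apply/eqP; rewrite eqEsubv; apply/andP; split; apply: sub.
    apply/span_subvP => _ /mapP[u + ->]; rewrite lT => /andP[uw up].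
    exact: positive_basis_span.
  apply: subv_trans (addvSr _ _); apply: sub_span => _ /mapP[b + ->].
  rewrite mem_filter => /andP[pb bin]; have [u [uE uw up]] := basis_mon bin.
  by rewrite /bvec -uE evec_mseq; apply: map_f; rewrite lT /T uw up.
have := chain_dim 0 R (map (@emon 5 n) l).
rewrite spanE dim_sub_basis // count_positive_basis addnC => /addnI ->.
rewrite size_map.
have -> : #|[set u : mon 5 n | [&& lex_eq n.+1 (weight u) w, posmon u & admissible u]]| =
    count (@admissible 5 n) l.
  rewrite cardE -(perm_size (_ : perm_eq (filter (@admissible 5 n) l) _)) ?size_filter //.
  apply: uniq_perm; [exact: filter_uniq|exact: enum_uniq|move=> u].
  by rewrite mem_filter lT mem_enum inE /T andbC andbA.
rewrite -sum1_count big_mkcond.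
(* A default element for [nth]. *)
have [u0 _] : exists u : mon 5 n, true.
  have b0 : nth (0%N, [::]) basis 0 \in basis by rewrite mem_nth ?size_basis.
  by have [u _] := basis_mon b0; exists u.
rewrite (big_nth u0) big_mkord; apply: eq_bigr => i _.
have il := ltn_ord i; rewrite (nth_map u0) //.
have Ti : T (nth u0 l i) by rewrite -lT mem_nth.
rewrite (admissible_positive Ti) -map_take.
have leS_refl : reflexive leS by move=> u; apply: sigma_lt_irr.
(* The entries before position [i] of the sorted list are the positive monomials of this weight that
   are smaller than entry [i]. *)
suff E : map (@emon 5 n) (take i l) =i
    [seq emon v | v <- enum (mon 5 n) & T v && sigma_lt v (nth u0 l i)].
  by rewrite (eq_span E); case: (_ \in _).
apply: eq_mem_map => v; rewrite mem_filter mem_enum andbT -lT.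
case: (boolP (v \in l)) => vl /=; last by apply: contraNF vl; apply: mem_take.
have vi : (index v l < size l)%N by rewrite index_mem.
rewrite in_take //; case: ltnP => [lt|le]; apply/esym.
  have := sorted_ltn_nth leS_trans u0 lS _ _ vi il lt; rewrite nth_index // => vu.
  have ne : v != nth u0 l i.
    by apply: contraL lt => /eqP->; rewrite index_uniq // ltnn.
  by case/orP: (sigma_lt_total ne) => // uv; rewrite /leS uv in vu.
apply: negbTE; have := sorted_leq_nth leS_trans leS_refl u0 lS _ _ il vi le.
by rewrite nth_index.
Qed.
End Main.

Unset Implicit Arguments.

Theorem theorem3p5 (d : nat) : (6 <= d)%N ->
  let w := omega_d d in
  let n := wdeg d w in
  #|[set u : mon 5 n | [&& lex_eq n.+1 (weight u) w, posmon u & admissible u]]| = 290%N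
  /\ dimQPplus 5 n w = 290%N
  /\ dimQP 5 n w = 465%N.
Proof.
case: d => [|[|s]] // s4 w n.
have nE : n = wdegree s := wdegE s.
have wE : forall i, w i = nth 0%N (wvec s) i := omega_dE s.
split; first exact: (admissible_count s4 nE wE).
by split; [exact: (dimQPplus_main s4 nE wE)|exact: (dimQP_main s4 nE wE)].
Qed.
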